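(* Let $V$ and $W$ be operator spaces. Then the identity map on the algebraic tensor product $V\otimes W$ extends to a linear contraction $$\Psi_{V,W}: V\mathbin{\widehat{\otimes}} W \to V\otimes_{\rm min} \widetilde{W},$$ where $\widetilde{W}$ denotes the opposite operator space of $W$.
   Context: All operator spaces are over $\mathbb{C}$ and are assumed, as part of the definition, to be complete: an operator space is a complex vector space $W$ with a sequence of complete norms $\|\cdot\|_{(n)}$ on $M_n(W)=\mathbb{M}_n\otimes W$ ($n\ge 1$) satisfying Ruan's axioms. Opposite operator space: $\widetilde{W}$ is the same vector space $W$ equipped with the matrix norms $\left\|\sum_i a_i\otimes w_i\right\|_{(n),{\rm opp}} := \left\|\sum_i a_i^\top\otimes w_i\right\|_{(n)}$ for $a_i\in\mathbb{M}_n$, $w_i\in W$, where $a^\top$ is the matrix transpose. Thus $W$ and $\widetilde{W}$ have the same underlying Banach space. Tensor products: $E\otimes F$ denotes the algebraic tensor product of vector spaces. $E\mathbin{\widehat{\otimes}}F$ denotes the (completed) operator-space projective tensor product: the completion of $E\otimes F$ characterized by natural completely isometric identifications $CB(E\mathbin{\widehat{\otimes}}F,G)\cong CB_{\rm bil}(E\times F;G)\cong CB(E,CB(F,G))$ for all operator spaces $G$. Here $CB$ denotes the space of completely bounded linear maps, and $CB_{\rm bil}(E\times F;G)$ is the space of bilinear maps $h:E\times F\to G$ with finite norm $\sup_{m,n}\{\|[h(x_{ij},y_{pq})]\|_{M_{mn}(G)} : \|[x_{ij}]\|_{M_m(E)}\le 1,\ \|[y_{pq}]\|_{M_n(F)}\le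 1\}$. $E\otimes_{\rm min}F$ denotes the (completed) injective, also called minimal, operator-space tensor product: if $E\subseteq B(H)$ and $F\subseteq B(K)$ completely isometrically, it is the norm closure of $E\otimes F$ in $B(H\otimes_2 K)$, where $\otimes_2$ is the Hilbert-space tensor product. ''Linear contraction'' means a linear map of norm at most $1$ between the underlying Banach spaces (complete boundedness is not asserted). *)

(* Defs.v *)
From HB Require Import structures.
From mathcomp Require Import all_boot all_order all_algebra.
From mathcomp Require Import complex mxtens ring.
From mathcomp Require Import all_classical all_reals all_analysis.

Set Implicit Arguments.
Unset Strict Implicit.
Unset Printing Implicit Defensive.

Import Order.TTheory GRing.Theory Num.Theory.
Import numFieldNormedType.Exports.
Import Normc.

Local Open Scope classical_set_scope.
Local Open Scope ring_scope.

Definition complete_for (R : realType) (X : zmodType) (N : X -> R) : Prop :=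
  forall u : nat -> X,
    (forall e : R, 0 < e -> \forall k & l \near \oo, N (u k - u l) < e) ->
    exists x : X, (fun k => N (u k - x)) @ \oo --> (0 : R).

Definition l2norm (R : realType) (n : nat) (v : 'cV[R[i]]_n) : R :=
  Num.sqrt (\sum_(i < n) normc (v i 0) ^+ 2).

Definition mxopnorm (R : realType) (m n : nat) (a : 'M[R[i]]_(m, n)) : R :=
  sup [set l2norm (a *m v) | v in [set v : 'cV[R[i]]_n | l2norm v <= 1]].

(* The product a x b of a vector-valued matrix x with scalar matrices a, b. *)
Definition bimodmx (R : realType) (W : lmodType R[i]) (m n : nat)
    (a : 'M[R[i]]_(n, m)) (x : 'M[W]_m) (b : 'M[R[i]]_(m, n)) : 'M[W]_n :=
  \matrix_(i, j) \sum_k \sum_l (a i k * b l j) *: x k l.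

(* M_n(W) is 'M[W]_n; an elementary tensor a (x) w of M_n (x) W is the matrix
   with entries a i j *: w.  The index n = 0 is allowed: M_0(W) = 0 carries
   the zero norm, which adds nothing to the structure.  Ruan's axioms are
   opnorm_dsum and opnorm_bimod. *)
HB.mixin Record isOperatorSpace (R : realType) (W : Type)
    of GRing.Lmodule R[i] W := {
  opnorm : forall n : nat, 'M[W]_n -> R ;
  ler_opnormD : forall n (x y : 'M[W]_n),
    opnorm n (x + y) <= opnorm n x + opnorm n y ;
  opnormZ : forall n (c : R[i]) (x : 'M[W]_n),
    opnorm n (map_mx (fun w => c *: w) x) = normc c * opnorm n x ;
  opnorm_eq0 : forall n (x : 'M[W]_n), opnorm n x = 0 -> x = 0 ;
  opnorm_complete : forall n, complete_for (opnorm n) ;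
  opnorm_dsum : forall m n (x : 'M[W]_m) (y : 'M[W]_n),
    opnorm (m + n) (block_mx x 0 0 y) = Num.max (opnorm m x) (opnorm n y) ;
  opnorm_bimod : forall m n (a : 'M[R[i]]_(n, m)) (x : 'M[W]_m)
      (b : 'M[R[i]]_(m, n)),
    opnorm n (bimodmx a x b) <= mxopnorm a * opnorm m x * mxopnorm b
}.

#[short(type="opSpaceType")]
HB.structure Definition OperatorSpace (R : realType) :=
  {W of isOperatorSpace R W & GRing.Lmodule R[i] W}.

Arguments opnorm {R W n} : rename.

(* The norm of the underlying Banach space W = M_1(W). *)
Definition vnorm (R : realType) (W : opSpaceType R) (w : W) : R :=
  opnorm (const_mx w : 'M[W]_1).

Section transpose_opnorm.
Variable R : realType.
Local Notation C := R[i].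

Let normc_ge0 (z : C) : 0 <= normc z.
Proof. by case: z => a b; rewrite /= sqrtr_ge0. Qed.

Let normc_sum n (F : 'I_n -> C) : normc (\sum_i F i) <= \sum_i normc (F i).
Proof.
elim/big_ind2 : _ => [|x1 x2 y1 y2 h1 h2|//]; first by rewrite normc0.
by rewrite (le_trans (le_normcD _ _))// lerD.
Qed.

Let normc_sqrM (z : C) : z * z^*%C = (normc z ^+ 2)%:C%C.
Proof.
case: z => x y; rewrite /normc sqr_sqrtr ?addr_ge0 ?sqr_ge0//.
by apply/eqP; rewrite eq_complex/=; apply/andP; split; apply/eqP; ring.
Qed.

Let l2norm_ge0 n (v : 'cV[C]_n) : 0 <= l2norm v.
Proof. exact: sqrtr_ge0. Qed.

Let l2norm_sqr n (v : 'cV[C]_n) : l2norm v ^+ 2 = \sum_i normc (v i 0) ^+ 2.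
Proof. by rewrite sqr_sqrtr// sumr_ge0// => i _; rewrite sqr_ge0. Qed.

Let l2norm0_eq n (v : 'cV[C]_n) : l2norm v = 0 -> v = 0.
Proof.
move=> v0; have /eqP := l2norm_sqr v.
rewrite v0 expr0n/= eq_sym psumr_eq0 => [/allP h|i _]; last exact: sqr_ge0.
apply/matrixP => i j; rewrite ord1 mxE; apply: eq0_normc.
by have := h i (mem_index_enum i); rewrite sqrf_eq0 => /eqP.
Qed.

Let l2normZ n (r : R) (v : 'cV[C]_n) : 0 <= r ->
  l2norm (r%:C%C *: v) = r * l2norm v.
Proof.
move=> r0; apply: (pexpIrn (n := 2)) => //; rewrite ?nnegrE ?mulr_ge0//.
rewrite exprMn !l2norm_sqr mulr_sumr; apply: eq_bigr => i _.
rewrite mxE normcM exprMn; congr (_ * _).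
by rewrite /normc /= expr0n/= addr0 sqr_sqrtr// sqr_ge0.
Qed.

Let cauchy_schwarz n (F G : 'I_n -> C) (a b : R) : 0 <= a -> 0 <= b ->
  \sum_i normc (F i) ^+ 2 = a ^+ 2 -> \sum_i normc (G i) ^+ 2 = b ^+ 2 ->
  normc (\sum_i F i * G i) <= a * b.
Proof.
move=> a0 b0 Fa Gb.
have zero (K : 'I_n -> C) c : c = 0 -> \sum_i normc (K i) ^+ 2 = c ^+ 2 ->
    forall i, K i = 0.
  move=> -> /eqP; rewrite expr0n/= psumr_eq0 => [/allP h i|i _].
    apply: eq0_normc.
    by have := h i (mem_index_enum i); rewrite sqrf_eq0 => /eqP.
  exact: sqr_ge0.
have [aE|an0] := eqVneq a 0.
  rewrite big1 ?normc0 ?mulr_ge0// => i _.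
  by rewrite (zero _ _ aE Fa) mul0r.
have [bE|bn0] := eqVneq b 0.
  rewrite big1 ?normc0 ?mulr_ge0// => i _.
  by rewrite (zero _ _ bE Gb) mulr0.
apply: (le_trans (normc_sum _)).
have -> : a * b = \sum_i (a * b / 2) *
    (normc (F i) ^+ 2 / a ^+ 2 + normc (G i) ^+ 2 / b ^+ 2).
  rewrite -mulr_sumr big_split/= -!mulr_suml Fa Gb !divff ?sqrf_eq0//.
  by field.
apply: ler_sum => i _; rewrite normcM -subr_ge0.
set f := normc _; set g := normc _.
have -> : a * b / 2 * (f ^+ 2 / a ^+ 2 + g ^+ 2 / b ^+ 2) - f * g =
    a * b / 2 * (f / a - g / b) ^+ 2.
  have two : (2 : R) != 0 by rewrite pnatr_eq0.
  by field; rewrite an0 bn0.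
by rewrite mulr_ge0 ?sqr_ge0// divr_ge0 ?mulr_ge0.
Qed.

Let l2norm_mulmx_bounded m n (a : 'M[C]_(m, n)) :
  exists M : R, forall v, l2norm v <= 1 -> l2norm (a *m v) <= M.
Proof.
exists (Num.sqrt (\sum_i \sum_j normc (a i j) ^+ 2)) => v v1.
have s0 i : 0 <= \sum_j normc (a i j) ^+ 2.
  by apply: sumr_ge0 => j _; exact: sqr_ge0.
rewrite ler_wsqrtr// ler_sum// => i _.
rewrite -[leRHS](sqr_sqrtr (s0 i)) ler_sqr ?nnegrE ?sqrtr_ge0//.
rewrite mxE -[leRHS]mulr1.
apply: le_trans (_ : Num.sqrt (\sum_j normc (a i j) ^+ 2) * l2norm v <= _).
  apply: cauchy_schwarz; [exact: sqrtr_ge0|exact: l2norm_ge0| |].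
    by rewrite sqr_sqrtr.
  by rewrite l2norm_sqr.
by rewrite ler_wpM2l// sqrtr_ge0.
Qed.

Lemma l2norm_mulmx m n (a : 'M[C]_(m, n)) v :
  l2norm (a *m v) <= mxopnorm a * l2norm v.
Proof.
have [M hM] := l2norm_mulmx_bounded a.
have unit u : l2norm u <= 1 -> l2norm (a *m u) <= mxopnorm a.
  move=> u1; apply: sup_ubound; last by exists u.
  by exists M => _ [w /= w1 <-]; exact: hM.
have [v0|vn0] := eqVneq (l2norm v) 0.
  rewrite (l2norm0_eq v0) mulmx0.
  have -> : (0 : 'cV[C]_m) = (0 : R)%:C%C *: 0 by rewrite scaler0.
  have -> : (0 : 'cV[C]_n) = (0 : R)%:C%C *: 0 by rewrite scaler0.
  by rewrite !l2normZ// !mul0r mulr0.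
have vp : 0 < l2norm v by rewrite lt_neqAle eq_sym vn0 l2norm_ge0.
have i0 : 0 <= (l2norm v)^-1 by rewrite invr_ge0.
have := unit ((l2norm v)^-1%:C%C *: v).
rewrite -scalemxAr !l2normZ// mulVf// lexx => /(_ isT).
by rewrite ler_pdivrMl// mulrC.
Qed.

Let mxopnorm_trmx_le m n (a : 'M[C]_(m, n)) : mxopnorm a^T <= mxopnorm a.
Proof.
apply: ge_sup.
  exists (l2norm (a^T *m 0)), 0 => //=.
  have -> : (0 : 'cV[C]_m) = (0 : R)%:C%C *: 0 by rewrite scaler0.
  by rewrite l2normZ// mul0r.
move=> _ [v /= v1 <-]; set u := a^T *m v.
pose w : 'cV[C]_n := \col_i (u i 0)^*%C.
have nJ (z : C) : normc z^*%C = normc z by case: z => x y; rewrite /= sqrrN.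
have wu : l2norm w = l2norm u.
  by congr Num.sqrt; apply: eq_bigr => i _; rewrite mxE nJ.
have a0 : 0 <= mxopnorm a.
  have [M hM] := l2norm_mulmx_bounded a.
  have z1 : l2norm (0 : 'cV[C]_n) <= 1.
    have -> : (0 : 'cV[C]_n) = (0 : R)%:C%C *: 0 by rewrite scaler0.
    by rewrite l2normZ// mul0r.
  apply: le_trans (l2norm_ge0 (a *m 0)) _.
  apply: sup_ubound; last by exists 0.
  by exists M => _ [z /= ? <-]; exact: hM.
have key : l2norm u ^+ 2 <= mxopnorm a * l2norm u.
  have -> : l2norm u ^+ 2 = normc (\sum_k v k 0 * (a *m w) k 0).
    have -> : \sum_k v k 0 * (a *m w) k 0 = (l2norm u ^+ 2)%:C%C.
      rewrite l2norm_sqr rmorph_sum/=.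
      transitivity (\sum_i u i 0 * w i 0); last first.
        by apply: eq_bigr => i _; rewrite [w i 0]mxE normc_sqrM.
      under eq_bigr do rewrite mxE mulr_sumr.
      rewrite exchange_big/=; apply: eq_bigr => i _.
      rewrite [u i 0]mxE mulr_suml; apply: eq_bigr => k _.
      by rewrite [a^T i k]mxE mulrA [v k 0 * _]mulrC.
    by rewrite /= expr0n/= addr0 sqrtr_sqr ger0_norm// sqr_ge0.
  apply: le_trans (_ : l2norm v * l2norm (a *m w) <= _).
    by apply: cauchy_schwarz; rewrite ?l2norm_sqr.
  apply: le_trans (_ : 1 * (mxopnorm a * l2norm w) <= _).
    by apply: ler_pM => //; exact: l2norm_mulmx.
  by rewrite mul1r wu.
have [->//|un0] := eqVneq (l2norm u) 0.
have up : 0 < l2norm u by rewrite lt_neqAle eq_sym un0 l2norm_ge0.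
by move: key; rewrite expr2 ler_pM2r.
Qed.

Lemma mxopnorm_trmx m n (a : 'M[C]_(m, n)) : mxopnorm a^T = mxopnorm a.
Proof.
apply/eqP; rewrite eq_le mxopnorm_trmx_le/=.
by rewrite -{1}[a]trmxK mxopnorm_trmx_le.
Qed.

End transpose_opnorm.

(* The opposite operator space.  The map
   \sum_i a_i (x) w_i |-> \sum_i a_i^T (x) w_i of M_n (x) W is the transpose
   of 'M[W]_n. *)
Definition opposite (W : Type) : Type := W.

Section opposite.
Variables (R : realType) (W : opSpaceType R).

HB.instance Definition _ := GRing.Lmodule.copy (opposite W) W.

Let oppnorm n (x : 'M[opposite W]_n) : R := opnorm (x^T : 'M[W]_n).

Let oppnormD n (x y : 'M[opposite W]_n) :
  oppnorm (x + y) <= oppnorm x + oppnorm y.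
Proof. by rewrite /oppnorm raddfD; exact: ler_opnormD. Qed.

Let oppnormZ n (c : R[i]) (x : 'M[opposite W]_n) :
  oppnorm (map_mx (fun w => c *: w) x) = normc c * oppnorm x.
Proof. by rewrite /oppnorm -opnormZ map_trmx. Qed.

Let oppnorm_eq0 n (x : 'M[opposite W]_n) : oppnorm x = 0 -> x = 0.
Proof. by move=> /opnorm_eq0 /(congr1 trmx); rewrite trmxK trmx0. Qed.

Let oppnorm_complete n : complete_for (@oppnorm n).
Proof.
move=> u uC; have [] := @opnorm_complete R W n (fun k => (u k)^T).
  move=> e /uC; apply: filterS => -[k l] /=.
  by rewrite /oppnorm raddfB.
move=> x ux; exists x^T; rewrite [X in X @ _](_ : _ =
  (fun k => opnorm ((u k)^T - x)))//.
by apply/funext => k; rewrite /oppnorm raddfB/= trmxK.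
Qed.

Let oppnorm_dsum m n (x : 'M[opposite W]_m) (y : 'M[opposite W]_n) :
  oppnorm (block_mx x 0 0 y) = Num.max (oppnorm x) (oppnorm y).
Proof. by rewrite /oppnorm tr_block_mx !trmx0; exact: opnorm_dsum. Qed.

Let oppnorm_bimod m n (a : 'M[R[i]]_(n, m)) (x : 'M[opposite W]_m)
    (b : 'M[R[i]]_(m, n)) :
  oppnorm (bimodmx a x b) <= mxopnorm a * oppnorm x * mxopnorm b.
Proof.
rewrite /oppnorm; have -> : (bimodmx a x b)^T = bimodmx b^T x^T a^T.
  apply/matrixP => i j; rewrite !mxE exchange_big/=.
  by apply: eq_bigr => k _; apply: eq_bigr => l _; rewrite !mxE [a _ _ * _]mulrC.
apply: le_trans (@opnorm_bimod R W _ _ b^T x^T a^T) _.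
rewrite !mxopnorm_trmx.
by rewrite [leLHS]mulrC mulrA mulrAC.
Qed.

HB.instance Definition _ := isOperatorSpace.Build R (opposite W)
  oppnormD oppnormZ oppnorm_eq0 oppnorm_complete oppnorm_dsum oppnorm_bimod.

End opposite.

(* The matrix over M_m (x) M_n with entries f (x i j) (y p q), its rows being
   indexed by the pairs (i, p) and its columns by the pairs (j, q). *)
Definition kronmx (A B D : Type) (f : A -> B -> D) (m n : nat)
    (x : 'M[A]_m) (y : 'M[B]_n) : 'M[D]_(m * n) :=
  \matrix_(r, s) f (x (mxtens_unindex r).1 (mxtens_unindex s).1)
                   (y (mxtens_unindex r).2 (mxtens_unindex s).2).

Section completely_bounded.
Variables (R : realType) (E F G : opSpaceType R).

Definition cbnorm (f : E -> G) : \bar R :=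
  ereal_sup [set z | exists n (x : 'M[E]_n),
    opnorm x <= 1 /\ z = (opnorm (map_mx f x))%:E].

Definition cbnorm_bil (h : E -> F -> G) : \bar R :=
  ereal_sup [set z | exists m n (x : 'M[E]_m) (y : 'M[F]_n),
    [/\ opnorm x <= 1, opnorm y <= 1 & z = (opnorm (kronmx h x y))%:E]].

(* The matrix norms of CB(E, G) and CB_bil(E x F; G), for which
   M_k(CB(E, G)) = CB(E, M_k(G)) and
   M_k(CB_bil(E x F; G)) = CB_bil(E x F; M_k(G)) isometrically; M_m(M_k(G)) is
   identified with M_(k m)(G). *)
Definition cbnorm_mx k (f : 'M[E -> G]_k) : \bar R :=
  ereal_sup [set z | exists m (x : 'M[E]_m),
    opnorm x <= 1 /\ z = (opnorm (kronmx (fun g e => g e) f x))%:E].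

Definition cbnorm_bil_mx k (h : 'M[E -> F -> G]_k) : \bar R :=
  ereal_sup [set z | exists m n (x : 'M[E]_m) (y : 'M[F]_n),
    [/\ opnorm x <= 1, opnorm y <= 1 &
      z = (opnorm (kronmx (fun g b => g b)
                          (kronmx (fun g a => g a) h x) y))%:E]].

End completely_bounded.

(* T together with t is the algebraic tensor product of E and F. *)
Definition is_tensor (R : realType) (E F T : lmodType R[i])
    (t : {bilinear E -> F -> T}) : Prop :=
  forall (G : lmodType R[i]) (h : {bilinear E -> F -> G}),
    exists2 g : {linear T -> G}, (forall x y, g (t x y) = h x y) &
      forall g' : {linear T -> G},
        (forall x y, g' (t x y) = h x y) -> g' =1 g.

Definition dense_range (R : realType) (T : Type) (X : opSpaceType R)
    (j : T -> X) : Prop :=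
  forall (x : X) (e : R), 0 < e -> exists u : T, vnorm (x - j u) < e.

(* P together with j : T -> P is the operator space projective tensor product
   of E and F, where T = E (x) F via t: it is a completion of T for which
   f |-> f \o j \o t is, for every operator space G, a completely isometric
   bijection from CB(P, G) onto CB_bil(E x F; G).  The identification with
   CB(E, CB(F, G)) is currying, which does not involve P. *)
Record is_projective_tensor (R : realType) (E F : opSpaceType R)
    (T : lmodType R[i]) (t : {bilinear E -> F -> T})
    (P : opSpaceType R) (j : {linear T -> P}) : Prop := {
  projective_inj : injective j ;
  projective_dense : dense_range j ;
  projective_isometry : forall (G : opSpaceType R) (k : nat)
      (f : 'I_k -> 'I_k -> {linear P -> G}),
    (forall a b, (cbnorm (f a b) < +oo)%E) ->
    cbnorm_bil_mx (\matrix_(a, b) (fun x y => f a b (j (t x y)))) =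
    cbnorm_mx (\matrix_(a, b) (f a b : P -> G)) ;
  projective_lift : forall (G : opSpaceType R) (h : {bilinear E -> F -> G}),
    (cbnorm_bil h < +oo)%E ->
    exists2 f : {linear P -> G},
      (cbnorm f < +oo)%E & forall x y, f (j (t x y)) = h x y
}.

HB.mixin Record isHilbert (R : realType) (H : Type)
    of GRing.Lmodule R[i] H := {
  hdot : {dot H for (Num.conj : R[i] -> R[i])} ;
  hilbert_complete : complete_for (fun x : H => Num.sqrt (complex.Re (hdot x x)))
}.

#[short(type="hilbertType")]
HB.structure Definition Hilbert (R : realType) :=
  {H of isHilbert R H & GRing.Lmodule R[i] H}.

Arguments hdot {R H} : rename.

Definition hnorm (R : realType) (H : hilbertType R) (x : H) : R :=
  Num.sqrt (complex.Re (hdot x x)).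

(* L together with s is the Hilbert space tensor product of H and K. *)
Record is_hilbert_tensor (R : realType) (H K L : hilbertType R)
    (s : {bilinear H -> K -> L}) : Prop := {
  hilbert_tensor_dot : forall h h' k k',
    hdot (s h k) (s h' k') = hdot h h' * hdot k k' ;
  hilbert_tensor_dense : forall (x : L) (e : R), 0 < e ->
    exists n (h : 'I_n -> H) (k : 'I_n -> K),
      hnorm (x - \sum_(i < n) s (h i) (k i)) < e
}.

(* The norm on M_n(B(H)) = B(H^n), H^n being the Hilbert space direct sum. *)
Definition hnorm_col (R : realType) (H : hilbertType R) n (xi : 'cV[H]_n) : R :=
  Num.sqrt (\sum_(i < n) hnorm (xi i 0) ^+ 2).

Definition bhnorm (R : realType) (H : hilbertType R) n (A : 'M[H -> H]_n) :
    \bar R :=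
  ereal_sup [set (hnorm_col (\col_i \sum_(j < n) A i j (xi j 0)))%:E
            | xi in [set xi : 'cV[H]_n | hnorm_col xi <= 1]].

(* iota is a completely isometric linear embedding of W into B(H); that each
   iota w is bounded is part of the second condition. *)
Definition complete_embedding (R : realType) (W : opSpaceType R)
    (H : hilbertType R) (iota : W -> {linear H -> H}) : Prop :=
  (forall (c : R[i]) (v w : W) (h : H),
    iota (c *: v + w) h = c *: iota v h + iota w h) /\
  (forall n (x : 'M[W]_n),
    bhnorm (map_mx (fun w => iota w : H -> H) x) = (opnorm x)%:E).

(* M together with j : T -> M is the minimal tensor product of E and F, where
   T = E (x) F via t: for embeddings of E in B(H) and F in B(K), it is the
   completion of T which Theta identifies with the closure of E (x) F in
   B(L), where L is the Hilbert space tensor product of H and K. *)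
Record is_minimal_tensor (R : realType) (E F : opSpaceType R)
    (T : lmodType R[i]) (t : {bilinear E -> F -> T})
    (M : opSpaceType R) (j : {linear T -> M}) : Prop := {
  minimal_inj : injective j ;
  minimal_dense : dense_range j ;
  minimal_spatial : exists (H K L : hilbertType R) (s : {bilinear H -> K -> L})
      (iotaE : E -> {linear H -> H}) (iotaF : F -> {linear K -> K})
      (Theta : M -> {linear L -> L}),
    [/\ is_hilbert_tensor s,
        complete_embedding iotaE, complete_embedding iotaF,
        complete_embedding Theta &
        forall x y h k,
          Theta (j (t x y)) (s h k) = s (iotaE x h) (iotaF y k)]
}.

(* Main.v *)
Require Import Defs.
From HB Require Import structures.
From mathcomp Require Import all_boot all_order all_algebra.
From mathcomp Require Import complex mxtens ring lra.
From mathcomp Require Import all_classical all_reals all_analysis.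

Set Implicit Arguments.
Unset Strict Implicit.
Unset Printing Implicit Defensive.

Import Order.TTheory GRing.Theory Num.Theory.
Import numFieldNormedType.Exports.
Import Normc.

Local Open Scope classical_set_scope.
Local Open Scope ring_scope.
Local Open Scope sesquilinear_scope.

(** The norm of [jM u] in the minimal tensor product is computed from the
functionals [u |-> <Theta (jM u) xi, eta>] with [xi] and [eta] unit vectors of
the Hilbert space tensor product [L] of [H] and [K], and by density [xi] and
[eta] may be taken to be finite tensors. If the bilinear form
[(x, y) |-> <Theta (jM (t x y)) xi, eta>] on [V] and [W] is jointly completely
contractive, the universal property of the projective tensor product, applied
with target [C], bounds such a functional by the norm of [jP u]. This gives
[vnorm (jM u) <= vnorm (jP u)] ([minimal_le_projective]), and the identity of
the algebraic tensor product extends by density and completeness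
([contraction_extension]).

So let [x] and [y] be contractive matrices over [V] and [W], and let [v] and
[w] be unit vectors. The claim ([spatial_form_le]) is that
[ |sum v_ip w_jq <(x_ij (x) y_pq) xi, eta>| <= 1 ].
As the second factor is embedded through the opposite structure, it is the
transposed array [y_pq], with row index [q] and column index [p], that acts as
a contraction on a direct sum of copies of [K].

Write [xi = sum_b sg_b e_b (x) f_b] and [eta = sum_d ta_d e'_d (x) f'_d] with
families that are orthonormal up to vanishing members
([schmidt_decomposition]). The sum becomes
[sum_bd sg_b ta_d sum v_ip w_jq X_(i,d),(j,b) Y_(q,d),(p,b)], where
[X_(i,d),(j,b) = <x_ij e_b, e'_d>] and [Y_(q,d),(p,b) = <y_pq f_b, f'_d>] are
contractive scalar arrays. For a fixed [b], summing first over [j] and [p] and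
then using the Cauchy-Schwarz inequality over [d], [i], [q] bounds the inner
sums, taken with any weights in [d], by the largest weight. For a fixed [d]
the same holds with weights in [b], since transposed contractions are
contractions. In terms of operators, the first estimate pairs the trace norm
of [xi] with the operator norm of [eta] and the second one does the converse;
the Hilbert-Schmidt norms needed here lie halfway. The interpolation is
elementary: since [sg_b ta_d <= sg_b^2 / 2 + ta_d^2 / 2], the weight
[sg_b ta_d] is a sum of nonnegative weights bounded by [sg_b^2 / 2] and by
[ta_d^2 / 2], and the two parts contribute at most [1/2] each
([crossed_product_le]). *)

(** * Complex moduli *)

Section complex_modulus.
Variable R : realType.
Local Notation C := R[i].

Lemma normc_ge0 (z : C) : 0 <= normc z.
Proof. by case: z => a b; rewrite /= sqrtr_ge0. Qed.

Lemma normc_sum (I : finType) (F : I -> C) :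
  normc (\sum_i F i) <= \sum_i normc (F i).
Proof.
elim/big_ind2 : _ => [|x1 x2 y1 y2 h1 h2|//]; first by rewrite normc0.
by rewrite (le_trans (le_normcD _ _))// lerD.
Qed.

Definition sqn (z : C) : R := normc z ^+ 2.

Lemma sqn_ge0 z : 0 <= sqn z. Proof. exact: sqr_ge0. Qed.

Lemma sqnE (z : C) : sqn z = complex.Re z ^+ 2 + complex.Im z ^+ 2.
Proof. by case: z => x y; rewrite /sqn /= sqr_sqrtr// addr_ge0 ?sqr_ge0. Qed.

Lemma mulcJ_sqn (z : C) : z * z^*%C = (sqn z)%:C%C.
Proof.
rewrite sqnE; case: z => x y /=.
by apply/eqP; rewrite eq_complex/=; apply/andP; split; apply/eqP; ring.
Qed.

Lemma sqnM (z w : C) : sqn (z * w) = sqn z * sqn w.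
Proof. by rewrite /sqn normcM exprMn. Qed.

Lemma sqnJ (z : C) : sqn z^*%C = sqn z.
Proof. by rewrite !sqnE; case: z => x y /=; rewrite sqrrN. Qed.

Lemma normc_realc (r : R) : 0 <= r -> normc r%:C%C = r.
Proof. by move=> r0; rewrite /= expr0n/= addr0 sqrtr_sqr ger0_norm. Qed.

Lemma realcM (a b : R) : (a * b)%:C%C = a%:C%C * b%:C%C.
Proof. exact: rmorphM. Qed.

Lemma realcB (a b : R) : (a - b)%:C%C = a%:C%C - b%:C%C.
Proof. exact: rmorphB. Qed.

Lemma realc_sum (I : finType) (F : I -> R) :
  (\sum_i F i)%:C%C = \sum_i (F i)%:C%C.
Proof. exact: rmorph_sum. Qed.

Lemma normcM_le_mean (z w : C) : normc (z * w) <= (sqn z + sqn w) / 2.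
Proof.
rewrite normcM /sqn; have := sqr_ge0 (normc z - normc w).
move: (normc z) (normc w) => x y; rewrite sqrrB => h; lra.
Qed.

Lemma sum_sqnE (I : finType) (F : I -> C) :
  (\sum_i sqn (F i))%:C%C = \sum_i F i * (F i)^*%C.
Proof. by rewrite rmorph_sum/=; apply: eq_bigr => i _; rewrite mulcJ_sqn. Qed.

End complex_modulus.

(** * Contractive scalar arrays and the crossed product inequality *)

Section contractive_arrays.
Variable R : realType.
Local Notation C := R[i].

(** Arbitrary finite index types make it possible to index rows and columns
by pairs and to exchange their components freely. *)
Definition contractive (I J : finType) (X : I -> J -> C) : Prop :=
  forall c : J -> C, \sum_i sqn (\sum_j X i j * c j) <= \sum_j sqn (c j).

(** With [t = X^T c] one has [|t|^2 = <c, X t^*>], and the arithmetic-geometric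
mean inequality bounds this by [(|c|^2 + |t|^2) / 2]. *)
Lemma contractive_tr (I J : finType) (X : I -> J -> C) :
  contractive X -> contractive (fun j i => X i j).
Proof.
move=> hX c; pose t j := \sum_i X i j * c i.
set T := leLHS; have T0 : 0 <= T by apply: sumr_ge0 => j _; exact: sqn_ge0.
suff : T <= (\sum_i sqn (c i) + T) / 2 by lra.
have {1}-> : T = normc (\sum_i c i * \sum_j X i j * (t j)^*%C).
  rewrite -[LHS]normc_realc// [T%:C%C]sum_sqnE; congr normc.
  under [RHS]eq_bigr do rewrite mulr_sumr.
  rewrite exchange_big/=; apply: eq_bigr => j _.
  rewrite -/(t j) {1}/t mulr_suml; apply: eq_bigr => i _.
  by rewrite mulrCA mulrA.
apply: le_trans (normc_sum _) _.
apply: le_trans (ler_sum _ (fun i _ => normcM_le_mean _ _)) _.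
rewrite -mulr_suml big_split/= ler_pM2r ?invr_gt0// lerD2l.
apply: le_trans (hX _) _; rewrite /T.
by under eq_bigr do rewrite sqnJ.
Qed.

Lemma sum_pair (U : nmodType) (I J : finType) (F : I * J -> U) :
  \sum_ij F ij = \sum_i \sum_j F (i, j).
Proof. by rewrite pair_bigA; apply: eq_bigr => -[]. Qed.

Lemma contractive_slice (I D J B : finType) (X : I * D -> J * B -> C) b
    (c : J -> C) :
  contractive X ->
  \sum_i \sum_d sqn (\sum_j X (i, d) (j, b) * c j) <= \sum_j sqn (c j).
Proof.
move=> /(_ (fun jb => if jb.2 == b then c jb.1 else 0)) hX.
have delta (U : zmodType) (F : J * B -> U) :
    (forall jb, jb.2 != b -> F jb = 0) -> \sum_jb F jb = \sum_j F (j, b).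
  move=> F0; rewrite sum_pair; apply: eq_bigr => j _.
  by rewrite (bigD1 b)//= big1 ?addr0// => b' b'b; rewrite F0.
apply: le_trans (le_trans hX _).
  rewrite pair_bigA/= le_eqVlt; apply/orP; left; apply/eqP.
  apply: eq_bigr => -[i d] _; rewrite delta/=.
    by under [in RHS]eq_bigr do rewrite eqxx.
  by move=> jb /negbTE ->; rewrite mulr0.
rewrite delta/=; first by under eq_bigr do rewrite eqxx.
by move=> jb /negbTE ->; rewrite /sqn normc0 expr0n.
Qed.

(** With [b] fixed, [X] maps each column [w (_, q)] to an array in [i] and [d]
of no larger norm, and [Y] maps each row [v (i, _)] to an array in [q] and
[d]. Both results are families indexed by [d], [i], [q] with square sum at
most one, so the sum of their products costs only the largest weight. *)
Lemma weighted_product_le (I J P Q B D : finType)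
    (X : I * D -> J * B -> C) (Y : Q * D -> P * B -> C)
    (v : I * P -> C) (w : J * Q -> C) (al : B -> D -> R) (rho : B -> R) :
  contractive X -> contractive Y ->
  \sum_ip sqn (v ip) <= 1 -> \sum_jq sqn (w jq) <= 1 ->
  (forall b, 0 <= rho b) -> (forall b d, 0 <= al b d <= rho b) ->
  normc (\sum_b \sum_d (al b d)%:C%C * \sum_i \sum_q
     (\sum_j X (i, d) (j, b) * w (j, q)) * (\sum_p Y (q, d) (p, b) * v (i, p)))
  <= \sum_b rho b.
Proof.
move=> hX hY hv hw rho0 hal.
apply: le_trans (normc_sum _) _; apply: ler_sum => b _.
pose F d i q := \sum_j X (i, d) (j, b) * w (j, q).
pose G d i q := \sum_p Y (q, d) (p, b) * v (i, p).
have hF : \sum_d \sum_i \sum_q sqn (F d i q) <= 1.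
  apply: le_trans hw; rewrite sum_pair [leRHS]exchange_big/=.
  under eq_bigr do rewrite exchange_big/=.
  rewrite exchange_big/=; apply: ler_sum => q _.
  by rewrite exchange_big/=; exact: contractive_slice.
have hG : \sum_d \sum_i \sum_q sqn (G d i q) <= 1.
  apply: le_trans hv; rewrite sum_pair exchange_big/=; apply: ler_sum => i _.
  by rewrite exchange_big/=; exact: contractive_slice.
apply: le_trans (normc_sum _) _.
apply: (@le_trans _ _ (\sum_d rho b *
    \sum_i \sum_q (sqn (F d i q) + sqn (G d i q)) / 2)).
  apply: ler_sum => d _; rewrite normcM.
  have /andP[al0 alr] := hal b d.
  rewrite normc_realc// ler_pM ?normc_ge0//.
  do 2 (apply: le_trans (normc_sum _) _; apply: ler_sum => ? _).
  exact: normcM_le_mean.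
rewrite -mulr_sumr ler_piMr//.
under eq_bigr do under eq_bigr do rewrite -mulr_suml big_split/=.
under eq_bigr do rewrite -mulr_suml big_split/=.
rewrite -mulr_suml big_split/=; lra.
Qed.

(** The previous lemma alone would give [sum_b sg b * max_d ta d], which the
square sums of [sg] and [ta] do not control. Instead [sg b * ta d] is split
into a part that is at most [sg b ^+ 2 / 2], estimated for each [b], and a part
that is at most [ta d ^+ 2 / 2], estimated for each [d] after transposition of
both arrays. *)
Lemma crossed_product_le (I J P Q B D : finType)
    (X : I * D -> J * B -> C) (Y : Q * D -> P * B -> C)
    (v : I * P -> C) (w : J * Q -> C) (sg : B -> R) (ta : D -> R) :
  contractive X -> contractive Y ->
  \sum_ip sqn (v ip) <= 1 -> \sum_jq sqn (w jq) <= 1 ->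
  (forall b, 0 <= sg b) -> (forall d, 0 <= ta d) ->
  \sum_b sg b ^+ 2 <= 1 -> \sum_d ta d ^+ 2 <= 1 ->
  normc (\sum_b \sum_d (sg b * ta d)%:C%C * \sum_i \sum_q
     (\sum_j X (i, d) (j, b) * w (j, q)) * (\sum_p Y (q, d) (p, b) * v (i, p)))
  <= 1.
Proof.
move=> hX hY hv hw sg0 ta0 hsg hta.
pose al b d := Num.min (sg b ^+ 2 / 2) (sg b * ta d).
pose be d b := sg b * ta d - al b d.
have hal b d : 0 <= al b d <= sg b ^+ 2 / 2.
  by rewrite le_min ge_min lexx mulr_ge0 ?mulr_ge0 ?sqr_ge0 ?invr_ge0.
have hbe d b : 0 <= be d b <= ta d ^+ 2 / 2.
  rewrite subr_ge0 ge_min lexx orbT/= lerBlDr -lerBlDl le_min.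
  have := sqr_ge0 (sg b - ta d); have := sqr_ge0 (ta d).
  rewrite sqrrB => h1 h2; apply/andP; split; lra.
pose Z b d := \sum_i \sum_q
  (\sum_j X (i, d) (j, b) * w (j, q)) * (\sum_p Y (q, d) (p, b) * v (i, p)).
rewrite -[X in normc X]/(\sum_b \sum_d (sg b * ta d)%:C%C * Z b d).
(* The same sum, arranged for the estimate in which [d] is fixed. *)
have ZE b d : Z b d = \sum_j \sum_p
    (\sum_i X (i, d) (j, b) * v (i, p)) * (\sum_q Y (q, d) (p, b) * w (j, q)).
  pose f i q j p := X (i, d) (j, b) * w (j, q) * (Y (q, d) (p, b) * v (i, p)).
  transitivity (\sum_i \sum_q \sum_j \sum_p f i q j p).
    apply: eq_bigr => i _; apply: eq_bigr => q _.
    by rewrite mulr_suml; apply: eq_bigr => j _; rewrite mulr_sumr.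
  transitivity (\sum_j \sum_p \sum_i \sum_q f i q j p); last first.
    apply: eq_bigr => j _; apply: eq_bigr => p _.
    rewrite mulr_suml; apply: eq_bigr => i _; rewrite mulr_sumr.
    by apply: eq_bigr => q _; rewrite /f; ring.
  under eq_bigr do rewrite exchange_big/=.
  rewrite exchange_big/=; apply: eq_bigr => j _.
  under eq_bigr do rewrite exchange_big/=.
  by rewrite exchange_big.
have -> : \sum_b \sum_d (sg b * ta d)%:C%C * Z b d =
    \sum_b \sum_d (al b d)%:C%C * Z b d + \sum_d \sum_b (be d b)%:C%C * Z b d.
  rewrite [X in _ + X]exchange_big/= -big_split; apply: eq_bigr => b _ /=.
  rewrite -big_split; apply: eq_bigr => d _ /=.
  by rewrite -mulrDl -rmorphD/= /be addrC subrK.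
apply: le_trans (le_normcD _ _) _.
apply: (@le_trans _ _ (\sum_b sg b ^+ 2 / 2 + \sum_d ta d ^+ 2 / 2)); last first.
  rewrite -!mulr_suml; lra.
have half0 (r : R) : 0 <= r ^+ 2 / 2 by rewrite divr_ge0// sqr_ge0.
apply: lerD; first exact: weighted_product_le.
under eq_bigr do under eq_bigr do rewrite ZE.
apply: (weighted_product_le (X := fun jb id => X id jb)
  (Y := fun pb qd => Y qd pb)) => //; exact: contractive_tr.
Qed.

End contractive_arrays.
(** * Hilbert spaces and Bessel families *)

Section hilbert_families.
Variables (R : realType).
Local Notation C := R[i].

Variable (H : hilbertType R).
Implicit Types x y z : H.

Lemma hdotDl x y z : hdot (x + y) z = hdot x z + hdot y z.
Proof. exact: linearDl. Qed.
Lemma hdotBl x y z : hdot (x - y) z = hdot x z - hdot y z.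
Proof. exact: linearBl. Qed.
Lemma hdotDr x y z : hdot x (y + z) = hdot x y + hdot x z.
Proof. exact: linearDr. Qed.
Lemma hdotBr x y z : hdot x (y - z) = hdot x y - hdot x z.
Proof. exact: linearBr. Qed.
Lemma hdotZl a x y : hdot (a *: x) y = a * hdot x y.
Proof. exact: linearZl_LR. Qed.
Lemma hdotZr a x y : hdot x (a *: y) = a^*%C * hdot x y.
Proof. exact: (linearZr_LR (hdot : {dot H for (Num.conj : R[i] -> R[i])})). Qed.
Lemma hdot0l x : hdot 0 x = 0. Proof. exact: linear0l. Qed.
Lemma hdot0r x : hdot x 0 = 0. Proof. exact: linear0r. Qed.
Lemma hdot_suml (I : finType) (F : I -> H) x :
  hdot (\sum_i F i) x = \sum_i hdot (F i) x.
Proof. exact: linear_sumlz. Qed.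
Lemma hdot_sumr (I : finType) (F : I -> H) x :
  hdot x (\sum_i F i) = \sum_i hdot x (F i).
Proof. exact: linear_sumr. Qed.
Lemma hdotC x y : hdot x y = (hdot y x)^*%C.
Proof. by rewrite (hermC hdot) expr0 mul1r. Qed.

Lemma hnorm_ge0 x : 0 <= hnorm x. Proof. exact: sqrtr_ge0. Qed.

Lemma hdot_sqr x : hdot x x = (hnorm x ^+ 2)%:C%C.
Proof.
have := dnorm_ge0 hdot x; rewrite /hnorm; case: (hdot x x) => a b.
rewrite lecE/= => /andP[/eqP -> a0]; by rewrite sqr_sqrtr.
Qed.

Lemma hnorm_eq0 x : hnorm x = 0 -> x = 0.
Proof.
move=> x0; apply/eqP; rewrite -(dnorm_eq0 hdot).
by have := hdot_sqr x; rewrite x0 expr0n/= => ->.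
Qed.

Lemma hnorm_sqrZ a x : hnorm (a *: x) ^+ 2 = sqn a * hnorm x ^+ 2.
Proof.
apply: complexI; rewrite -hdot_sqr hdotZl hdotZr hdot_sqr mulrA mulcJ_sqn.
by rewrite -realcM.
Qed.

Lemma hnormZ a x : hnorm (a *: x) = normc a * hnorm x.
Proof.
apply: (pexpIrn (n := 2)) => //; rewrite ?nnegrE ?mulr_ge0 ?normc_ge0 ?hnorm_ge0//.
by rewrite hnorm_sqrZ exprMn.
Qed.

Lemma hdot_le x y : normc (hdot x y) <= hnorm x * hnorm y.
Proof.
have [/hnorm_eq0->|y0] := eqVneq (hnorm y) 0.
  by rewrite hdot0r normc0 mulr_ge0 ?hnorm_ge0.
have yp : 0 < hnorm y ^+ 2 by rewrite exprn_gt0// lt_neqAle eq_sym y0 hnorm_ge0.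
rewrite -ler_sqr ?nnegrE ?mulr_ge0 ?normc_ge0 ?hnorm_ge0// exprMn.
have := dnorm_ge0 hdot ((hnorm y ^+ 2)%:C%C *: x - hdot x y *: y).
rewrite hdotBl !hdotBr !hdotZl !hdotZr !hdot_sqr conjc_real (hdotC y x).
rewrite [hdot x y * (_ * (hdot x y)^*%C)]mulrCA.
rewrite [hdot x y * (_ * (hnorm y ^+ 2)%:C%C)]mulrA.
rewrite [(hdot x y)^*%C * _]mulrC !mulcJ_sqn -!realcM -!realcB ler0c -/(sqn _).
move: (hnorm y ^+ 2) (hnorm x ^+ 2) (sqn (hdot x y)) yp => Y X Z yp.
have -> : Y * (Y * X) - Y * Z - (Y * Z - Z * Y) = Y * (X * Y - Z) by ring.
by rewrite pmulr_rge0// subr_ge0.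
Qed.

Lemma hnorm_triangle x y : hnorm (x + y) <= hnorm x + hnorm y.
Proof.
rewrite -ler_sqr ?nnegrE ?addr_ge0 ?hnorm_ge0//.
have -> : hnorm (x + y) ^+ 2 =
    hnorm x ^+ 2 + hnorm y ^+ 2 + complex.Re (hdot x y) *+ 2.
  rewrite -[LHS]/(complex.Re (hnorm (x + y) ^+ 2)%:C%C) -hdot_sqr.
  rewrite hdotDl !hdotDr !hdot_sqr (hdotC y x); case: (hdot x y) => a b /=; ring.
suff : complex.Re (hdot x y) <= hnorm x * hnorm y.
  by rewrite sqrrD; move: (complex.Re _) => r h; lra.
apply: le_trans (hdot_le x y); case: (hdot x y) => a b /=.
apply: le_trans (ler_norm a) _; rewrite -sqrtr_sqr ler_wsqrtr// lerDl.
exact: sqr_ge0.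
Qed.

Lemma hnorm_sum_orth (I : finType) (F : I -> H) :
  (forall i j, i != j -> hdot (F i) (F j) = 0) ->
  hnorm (\sum_i F i) ^+ 2 = \sum_i hnorm (F i) ^+ 2.
Proof.
move=> orthF; apply: complexI; rewrite -hdot_sqr rmorph_sum/= hdot_suml.
apply: eq_bigr => i _; rewrite hdot_sumr (bigD1 i)//= big1 ?addr0 ?hdot_sqr//.
by move=> j ji; rewrite orthF// eq_sym.
Qed.

(** A Bessel family of bound one: an orthonormal family some of whose members
are replaced by zero is of this kind, and so is any image of it under a
unitary change of coefficients. *)
Definition bessel (I : finType) (e : I -> H) : Prop :=
  forall c : I -> C, hnorm (\sum_i c i *: e i) ^+ 2 <= \sum_i sqn (c i).

(** Bessel's inequality, by duality from the bound on linear combinations. *)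
Lemma bessel_dot (I : finType) (e : I -> H) z :
  bessel e -> \sum_i sqn (hdot z (e i)) <= hnorm z ^+ 2.
Proof.
move=> he; pose w := \sum_i hdot z (e i) *: e i.
set T := leLHS; have T0 : 0 <= T by apply: sumr_ge0 => j _; exact: sqn_ge0.
have TE : T = normc (hdot z w).
  rewrite -[LHS]normc_realc// [T%:C%C]sum_sqnE hdot_sumr; congr normc.
  by apply: eq_bigr => i _; rewrite hdotZr mulrC.
have wT : hnorm w ^+ 2 <= T := he _.
have := sqr_ge0 (hnorm z - hnorm w); have := hdot_le z w.
rewrite -TE sqrrB; lra.
Qed.

Lemma normalize_orthogonal (I : finType) (f : I -> H) :
  (forall i j, i != j -> hdot (f i) (f j) = 0) ->
  exists2 e : I -> H, bessel e & forall i, f i = (hnorm (f i))%:C%C *: e i.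
Proof.
move=> orthf; exists (fun i => ((hnorm (f i))^-1)%:C%C *: f i); last first.
  move=> i; have [/[dup] h /hnorm_eq0 ->|h] := eqVneq (hnorm (f i)) 0.
    by rewrite !scaler0.
  by rewrite scalerA -realcM/= divff// scale1r.
move=> c; rewrite hnorm_sum_orth => [|i j ij]; last first.
  by rewrite !(hdotZl, hdotZr) orthf// !mulr0.
apply: ler_sum => i _; rewrite scalerA hnorm_sqrZ sqnM -mulrA ler_piMr ?sqn_ge0//.
rewrite /sqn normc_realc ?invr_ge0 ?hnorm_ge0// -exprMn.
have [->|h] := eqVneq (hnorm (f i)) 0; first by rewrite mulr0 expr0n.
by rewrite mulVf// expr1n.
Qed.

(** The spectral theorem for the Gram matrix of [k]. *)
Lemma unitary_orthogonalize n (k : 'I_n -> H) :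
  exists2 U : 'I_n -> 'I_n -> C,
    (forall l m, \sum_b (U b l)^*%C * U b m = (l == m)%:R) &
    forall b c, b != c ->
      hdot (\sum_l U b l *: k l) (\sum_l U c l *: k l) = 0.
Proof.
pose G : 'M[C]_n := \matrix_(a, b) hdot (k a) (k b).
have Gn : G \is normalmx.
  apply: hermitian_normalmx; apply/is_hermitianmxP; rewrite expr0 scale1r.
  by apply/matrixP => a b; rewrite !mxE hdotC.
have Uu := spectral_unitarymx G.
have /orthomx_spectralP := Gn; rewrite invmx_unitary//.
set U := spectralmx G in Uu *; set D := diag_mx _ => GE.
exists (fun b l => U b l) => [l m|b c bc].
  have /matrixP/(_ l m) : U^t* *m U = 1%:M.
    by rewrite -invmx_unitary// mulVmx ?spectral_unit.
  by rewrite !mxE => <-; apply: eq_bigr => b _; rewrite !mxE.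
have /matrixP/(_ b c) : U *m G *m U^t* = D.
  by rewrite GE !mulmxA (unitarymxP Uu) mul1mx -mulmxA (unitarymxP Uu) mulmx1.
rewrite [D b c]mxE (negbTE bc) mulr0n => <-.
rewrite -mulmxA mxE hdot_suml; apply: eq_bigr => l _.
rewrite hdotZl hdot_sumr mxE; congr (_ * _); apply: eq_bigr => m _.
by rewrite hdotZr !mxE mulrC.
Qed.

End hilbert_families.
(** * Schmidt decomposition of finite tensors *)

Section schmidt_decomposition.
Variables (R : realType).
Local Notation C := R[i].

(** Unitarity in the form [U^* U = 1], which is the relation that preserves
norms and tensors. *)
Definition isometric n (U : 'I_n -> 'I_n -> C) : Prop :=
  forall l m, \sum_b (U b l)^*%C * U b m = (l == m)%:R.

Lemma sum_isometric (W : lmodType C) n (U : 'I_n -> 'I_n -> C)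
    (F : 'I_n -> 'I_n -> W) : isometric U ->
  \sum_b \sum_l \sum_m ((U b l)^*%C * U b m) *: F l m = \sum_l F l l.
Proof.
move=> hU; rewrite exchange_big/=; apply: eq_bigr => l _.
rewrite exchange_big/= (bigD1 l)//= -scaler_suml hU eqxx scale1r.
by rewrite big1 ?addr0// => m ml; rewrite -scaler_suml hU eq_sym (negbTE ml) scale0r.
Qed.

(** A tensor does not change when a unitary acts on the left factors and its
conjugate on the right ones. *)
Lemma isometric_bilinear (U1 U2 W : lmodType C) (s : {bilinear U1 -> U2 -> W})
    n (U : 'I_n -> 'I_n -> C) (h : 'I_n -> U1) (k : 'I_n -> U2) :
  isometric U ->
  \sum_b s (\sum_l (U b l)^*%C *: h l) (\sum_m U b m *: k m) =
  \sum_l s (h l) (k l).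
Proof.
move=> /(sum_isometric (fun l m => s (h l) (k m))) <-; apply: eq_bigr => b _.
rewrite linear_sumlz; apply: eq_bigr => l _.
rewrite linearZl_LR linear_sumr/= scaler_sumr; apply: eq_bigr => m _.
by rewrite linearZr_LR scalerA.
Qed.

Lemma isometric_conj n (U : 'I_n -> 'I_n -> C) :
  isometric U -> isometric (fun b l => (U b l)^*%C).
Proof.
move=> hU l m; under eq_bigr do rewrite mulrC.
rewrite (eq_bigr (fun b => (U b m)^*%C * U b l)) ?hU 1?eq_sym// => b _.
by rewrite conjcK.
Qed.

Lemma isometric_contractive n (U : 'I_n -> 'I_n -> C) :
  isometric U -> contractive U.
Proof.
move=> hU c; rewrite -lecR sum_sqnE.
rewrite (_ : \sum_b _ = \sum_b \sum_l \sum_m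
  ((U b l)^*%C * U b m) *: ((c l)^*%C * c m)); last first.
  apply: eq_bigr => b _; rewrite rmorph_sum mulrC mulr_suml.
  apply: eq_bigr => l _; rewrite mulr_sumr; apply: eq_bigr => m _.
  by rewrite rmorphM; rewrite -[RHS]/(_ * _); ring.
rewrite (sum_isometric (W := C^o)) // sum_sqnE.
by under eq_bigr do rewrite mulrC.
Qed.

Lemma hnorm_sum_isometric (H : hilbertType R) n (U : 'I_n -> 'I_n -> C)
    (h : 'I_n -> H) : isometric U ->
  \sum_b hnorm (\sum_l U b l *: h l) ^+ 2 = \sum_l hnorm (h l) ^+ 2.
Proof.
move=> hU; apply: complexI; rewrite 2!realc_sum.
rewrite (eq_bigr _ (fun b _ => esym (hdot_sqr _))).
rewrite [RHS](eq_bigr _ (fun l _ => esym (hdot_sqr _))).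
rewrite -(sum_isometric (W := C^o) (fun l m => hdot (h m) (h l)) hU).
apply: eq_bigr => b _; rewrite hdot_sumr; apply: eq_bigr => l _.
rewrite hdotZr hdot_suml mulr_sumr; apply: eq_bigr => m _.
by rewrite hdotZl mulrA.
Qed.

Lemma bessel_isometric (H : hilbertType R) n (U : 'I_n -> 'I_n -> C)
    (e : 'I_n -> H) : isometric U -> bessel e ->
  bessel (fun b => \sum_l U b l *: e l).
Proof.
move=> /isometric_contractive/contractive_tr hU he c.
apply: le_trans (hU c).
rewrite (_ : \sum_b _ = \sum_l (\sum_b U b l * c b) *: e l); first exact: he.
under eq_bigr do rewrite scaler_sumr.
rewrite exchange_big/=; apply: eq_bigr => l _; rewrite scaler_suml.
by apply: eq_bigr => b _; rewrite scalerA mulrC.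
Qed.

Lemma hnorm_sum_tensor (H K L : hilbertType R) (s : {bilinear H -> K -> L})
    n (h : 'I_n -> H) (k : 'I_n -> K) :
  (forall h h' k k', hdot (s h k) (s h' k') = hdot h h' * hdot k k') ->
  (forall b c, b != c -> hdot (k b) (k c) = 0) ->
  hnorm (\sum_b s (h b) (k b)) ^+ 2 =
  \sum_b hnorm ((hnorm (k b))%:C%C *: h b) ^+ 2.
Proof.
move=> hs orthk; rewrite hnorm_sum_orth => [|b c bc]; last first.
  by rewrite hs orthk// mulr0.
apply: eq_bigr => b _; apply: complexI.
rewrite -hdot_sqr hs hnorm_sqrZ /sqn normc_realc ?hnorm_ge0//.
rewrite [RHS]realcM -!hdot_sqr.
exact: mulrC.
Qed.

(** The singular value decomposition of a finite tensor, with Bessel families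
in place of orthonormal ones. The Gram matrix of the right factors is
diagonalized first and their norms are moved to the left factors, whose Gram
matrix is then diagonalized by a second unitary. The norm of the tensor is
computed between the two steps, when the right factors are still orthogonal,
so right factors that vanish need not be discarded. *)
Lemma schmidt_decomposition (H K L : hilbertType R)
    (s : {bilinear H -> K -> L}) n (h : 'I_n -> H) (k : 'I_n -> K) :
  (forall h h' k k', hdot (s h k) (s h' k') = hdot h h' * hdot k k') ->
  exists (sg : 'I_n -> R) (e : 'I_n -> H) (f : 'I_n -> K),
    [/\ forall b, 0 <= sg b, bessel e, bessel f,
        \sum_b sg b ^+ 2 = hnorm (\sum_l s (h l) (k l)) ^+ 2 &
        \sum_l s (h l) (k l) = \sum_b (sg b)%:C%C *: s (e b) (f b)].
Proof.
move=> hs; have [U hU orthk] := unitary_orthogonalize k.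
have [f hf kf] := normalize_orthogonal orthk.
pose h1 b := \sum_l (U b l)^*%C *: h l; pose k1 b := \sum_m U b m *: k m.
have -> : \sum_l s (h l) (k l) = \sum_b s (h1 b) (k1 b).
  by rewrite isometric_bilinear.
have NE := hnorm_sum_tensor h1 hs orthk.
pose g b := (hnorm (k1 b))%:C%C *: h1 b.
have gE b : s (h1 b) (k1 b) = s (g b) (f b).
  by rewrite [k1 b]kf linearZr_LR -linearZl_LR.
have [V hV orthg] := unitary_orthogonalize g.
have [e he ge] := normalize_orthogonal orthg.
exists (fun b => hnorm (\sum_l V b l *: g l)), e.
exists (fun b => \sum_l (V b l)^*%C *: f l); split=> //.
- by move=> b; exact: hnorm_ge0.
- by apply: bessel_isometric => //; exact: isometric_conj.
- by rewrite NE hnorm_sum_isometric.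
under eq_bigr do rewrite gE.
rewrite -(isometric_bilinear s g f (isometric_conj hV)).
apply: eq_bigr => b _; rewrite -linearZl_LR/= -ge; congr (s _ _).
by apply: eq_bigr => l _; rewrite conjcK.
Qed.

(** Compression of an operator matrix: Bessel families define contractions
into [H^n] on the right of [A] and out of [H^m] on its left. *)
Lemma contractive_entries (H : hilbertType R) m n N N'
    (A : 'I_m -> 'I_n -> {linear H -> H}) (e : 'I_N -> H) (f : 'I_N' -> H) :
  (forall xi : 'I_n -> H,
     \sum_i hnorm (\sum_j A i j (xi j)) ^+ 2 <= \sum_j hnorm (xi j) ^+ 2) ->
  bessel e -> bessel f ->
  contractive (fun (id : 'I_m * 'I_N') (jb : 'I_n * 'I_N) =>
    hdot (A id.1 jb.1 (e jb.2)) (f id.2)).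
Proof.
move=> hA he hf c; pose xi j := \sum_b c (j, b) *: e b.
rewrite !sum_pair/=; apply: (@le_trans _ _ (\sum_j hnorm (xi j) ^+ 2)); last first.
  by apply: ler_sum => j _; exact: he.
apply: le_trans (hA xi); apply: ler_sum => i _.
apply: le_trans (bessel_dot _ hf); apply: ler_sum => d _.
rewrite le_eqVlt; apply/orP; left; apply/eqP; congr sqn.
rewrite hdot_suml sum_pair/=; apply: eq_bigr => j _.
rewrite /xi linear_sum hdot_suml; apply: eq_bigr => b _.
by rewrite linearZ hdotZl mulrC.
Qed.

End schmidt_decomposition.
(** * The operator norm of scalar matrices *)

Section scalar_matrices.
Variable R : realType.
Local Notation C := R[i].

Lemma l2norm_ge0 n (v : 'cV[C]_n) : 0 <= l2norm v.
Proof. exact: sqrtr_ge0. Qed.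

Lemma l2norm_sqr n (v : 'cV[C]_n) : l2norm v ^+ 2 = \sum_i sqn (v i 0).
Proof. by rewrite sqr_sqrtr// sumr_ge0// => i _; rewrite sqn_ge0. Qed.

Lemma l2norm_le n (v : 'cV[C]_n) (r : R) :
  0 <= r -> (l2norm v <= r) = (\sum_i sqn (v i 0) <= r ^+ 2).
Proof. by move=> r0; rewrite -l2norm_sqr ler_sqr ?nnegrE ?l2norm_ge0. Qed.

Lemma l2norm0 n : l2norm (0 : 'cV[C]_n) = 0.
Proof.
by rewrite /l2norm big1 ?sqrtr0// => i _; rewrite mxE normc0 expr0n.
Qed.

Lemma l2norm_eq0 n (v : 'cV[C]_n) : l2norm v = 0 -> v = 0.
Proof.
move=> v0; have /eqP := l2norm_sqr v.
rewrite v0 expr0n/= eq_sym psumr_eq0 => [/allP h|i _]; last exact: sqn_ge0.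
apply/matrixP => i j; rewrite ord1 mxE; apply: eq0_normc.
by have := h i (mem_index_enum i); rewrite sqrf_eq0 => /eqP.
Qed.

(** With [t = |u|] and [s = |v|], summing
[|u_i + v_i|^2 <= (1 + s / t) |u_i|^2 + (1 + t / s) |v_i|^2] gives
[(t + s)^2]. *)
Lemma l2normD n (u v : 'cV[C]_n) : l2norm (u + v) <= l2norm u + l2norm v.
Proof.
have [/l2norm_eq0 ->|u0] := eqVneq (l2norm u) 0.
  by rewrite add0r l2norm0 add0r.
have [/l2norm_eq0 ->|v0] := eqVneq (l2norm v) 0.
  by rewrite addr0 l2norm0 addr0.
rewrite l2norm_le ?addr_ge0 ?l2norm_ge0//.
have up : 0 < l2norm u by rewrite lt_neqAle eq_sym u0 l2norm_ge0.
have vp : 0 < l2norm v by rewrite lt_neqAle eq_sym v0 l2norm_ge0.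
have := l2norm_sqr u; have := l2norm_sqr v.
move: (l2norm u) (l2norm v) u0 v0 up vp => t s t0 s0 tp sp hs ht.
apply: (@le_trans _ _ (\sum_i
    ((1 + s / t) * sqn (u i 0) + (1 + t / s) * sqn (v i 0)))).
  apply: ler_sum => i _; rewrite mxE /sqn.
  have := le_normcD (u i 0) (v i 0).
  have := normc_ge0 (u i 0 + v i 0).
  move: (normc (u i 0 + v i 0)) (normc (u i 0)) (normc (v i 0)) => c a b c0 h.
  apply: (@le_trans _ _ ((a + b) ^+ 2)).
    by rewrite ler_sqr ?nnegrE// (le_trans c0).
  rewrite -subr_ge0.
  have -> : (1 + s / t) * a ^+ 2 + (1 + t / s) * b ^+ 2 - (a + b) ^+ 2 =
    s / t * (a - t / s * b) ^+ 2 by field; rewrite t0 s0.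
  by rewrite mulr_ge0 ?sqr_ge0// divr_ge0 ?ltW.
rewrite big_split/= -!mulr_sumr -hs -ht le_eqVlt; apply/orP; left; apply/eqP.
by field; rewrite t0 s0.
Qed.

Lemma mxopnorm_le m n (a : 'M[C]_(m, n)) (r : R) : 0 <= r ->
  (forall v, l2norm (a *m v) <= r * l2norm v) -> mxopnorm a <= r.
Proof.
move=> r0 h; apply: ge_sup.
  by exists (l2norm (a *m 0)), 0 => //=; rewrite l2norm0.
by move=> _ [v /= v1 <-]; rewrite (le_trans (h v))// ler_piMr.
Qed.

Lemma normc_le_mxopnorm m n (a : 'M[C]_(m, n)) i j : normc (a i j) <= mxopnorm a.
Proof.
have := l2norm_mulmx a (delta_mx j 0).
have -> : l2norm (delta_mx j 0 : 'cV[C]_n) = 1.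
  rewrite /l2norm (bigD1 j)//= mxE !eqxx normc1 expr1n big1 ?addr0 ?sqrtr1//.
  by move=> k /negbTE kj; rewrite mxE kj normc0 expr0n.
rewrite mulr1; apply: le_trans; rewrite -colE.
rewrite -ler_sqr ?nnegrE ?normc_ge0 ?l2norm_ge0// l2norm_sqr (bigD1 i)//= mxE.
by rewrite lerDl sumr_ge0// => k _; exact: sqn_ge0.
Qed.

Lemma mxopnorm_ge0 m n (a : 'M[C]_(m, n)) : 0 <= mxopnorm a.
Proof.
rewrite -(l2norm0 m) -(mulmx0 _ a); apply: ub_le_sup; last first.
  by exists 0 => //=; rewrite l2norm0.
exists `|mxopnorm a| => _ [v /= v1 <-].
apply: le_trans (l2norm_mulmx a v) _.
apply: le_trans (ler_norm _) _; rewrite normrM ler_piMr//.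
by rewrite ger0_norm ?l2norm_ge0.
Qed.

Lemma mxopnormM m n p (a : 'M[C]_(m, n)) (b : 'M[C]_(n, p)) :
  mxopnorm (a *m b) <= mxopnorm a * mxopnorm b.
Proof.
apply: mxopnorm_le => [|v]; first by rewrite mulr_ge0 ?mxopnorm_ge0.
rewrite -mulmxA -mulrA; apply: le_trans (l2norm_mulmx _ _) _.
by rewrite ler_wpM2l ?mxopnorm_ge0 ?l2norm_mulmx.
Qed.

Lemma mxopnormD m n (a b : 'M[C]_(m, n)) :
  mxopnorm (a + b) <= mxopnorm a + mxopnorm b.
Proof.
apply: mxopnorm_le => [|v]; first by rewrite addr_ge0 ?mxopnorm_ge0.
rewrite mulmxDl mulrDl; apply: le_trans (l2normD _ _) _.
by apply: lerD; exact: l2norm_mulmx.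
Qed.

Lemma l2normZ n c (v : 'cV[C]_n) : l2norm (c *: v) = normc c * l2norm v.
Proof.
apply: (pexpIrn (n := 2)) => //; rewrite ?nnegrE ?mulr_ge0 ?l2norm_ge0 ?normc_ge0//.
rewrite exprMn !l2norm_sqr mulr_sumr; apply: eq_bigr => i _.
by rewrite mxE sqnM.
Qed.

Lemma mxopnormZ_le m n c (a : 'M[C]_(m, n)) :
  mxopnorm (c *: a) <= normc c * mxopnorm a.
Proof.
apply: mxopnorm_le => [|v]; first by rewrite mulr_ge0 ?mxopnorm_ge0 ?normc_ge0.
by rewrite -scalemxAl l2normZ -mulrA ler_wpM2l ?normc_ge0 ?l2norm_mulmx.
Qed.

Lemma mxopnormZ m n c (a : 'M[C]_(m, n)) : mxopnorm (c *: a) = normc c * mxopnorm a.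
Proof.
have [->|c0] := eqVneq c 0.
  rewrite scale0r normc0 mul0r; apply/eqP; rewrite eq_le mxopnorm_ge0 andbT.
  by apply: mxopnorm_le => // v; rewrite mul0mx l2norm0 mul0r.
apply/eqP; rewrite eq_le mxopnormZ_le/=.
rewrite -{1}[a]scale1r -(mulVf c0) -scalerA.
have cp : 0 < normc c.
  rewrite lt_neqAle normc_ge0 andbT eq_sym; apply: contra c0 => /eqP h.
  by apply/eqP; exact: eq0_normc.
by rewrite mulrC -ler_pdivlMr// mulrC -normcV mxopnormZ_le.
Qed.

Lemma mxopnorm_eq0 m n (a : 'M[C]_(m, n)) : mxopnorm a = 0 -> a = 0.
Proof.
move=> a0; apply/matrixP => i j; rewrite mxE; apply: eq0_normc.
by apply/eqP; rewrite eq_le normc_ge0 -{1}a0 normc_le_mxopnorm.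
Qed.

Lemma mxopnorm_block_diag m n (a : 'M[C]_m) (b : 'M[C]_n) :
  mxopnorm (block_mx a 0 0 b) = Num.max (mxopnorm a) (mxopnorm b).
Proof.
have col_sqr p q (u : 'cV[C]_p) (v : 'cV[C]_q) :
    l2norm (col_mx u v) ^+ 2 = l2norm u ^+ 2 + l2norm v ^+ 2.
  rewrite !l2norm_sqr big_split_ord/=; congr (_ + _); apply: eq_bigr => i _.
    by rewrite col_mxEu.
  by rewrite col_mxEd.
have blockM (u : 'cV_m) (v : 'cV_n) :
    block_mx a 0 0 b *m col_mx u v = col_mx (a *m u) (b *m v).
  by rewrite mul_block_col !mul0mx addr0 add0r.
apply/eqP; rewrite eq_le ge_max; apply/andP; split; last (apply/andP; split).
- have M0 : 0 <= Num.max (mxopnorm a) (mxopnorm b) by rewrite le_max mxopnorm_ge0.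
  apply: mxopnorm_le => // v; rewrite -[v]vsubmxK blockM.
  rewrite -ler_sqr ?nnegrE ?mulr_ge0 ?l2norm_ge0// exprMn !col_sqr mulrDr -!exprMn.
  apply: lerD; rewrite ler_sqr ?nnegrE ?mulr_ge0 ?l2norm_ge0//;
    apply: le_trans (l2norm_mulmx _ _) _;
    by rewrite ler_wpM2r ?l2norm_ge0// le_max lexx ?orbT.
- apply: mxopnorm_le => [|v]; first exact: mxopnorm_ge0.
  have := l2norm_mulmx (block_mx a 0 0 b) (col_mx v 0).
  rewrite blockM mulmx0 -ler_sqr ?nnegrE ?mulr_ge0 ?mxopnorm_ge0 ?l2norm_ge0//.
  rewrite exprMn !col_sqr !l2norm0 expr0n/= !addr0 -exprMn.
  by rewrite ler_sqr ?nnegrE ?mulr_ge0 ?mxopnorm_ge0 ?l2norm_ge0.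
- apply: mxopnorm_le => [|v]; first exact: mxopnorm_ge0.
  have := l2norm_mulmx (block_mx a 0 0 b) (col_mx 0 v).
  rewrite blockM mulmx0 -ler_sqr ?nnegrE ?mulr_ge0 ?mxopnorm_ge0 ?l2norm_ge0//.
  rewrite exprMn !col_sqr !l2norm0 expr0n/= !add0r -exprMn.
  by rewrite ler_sqr ?nnegrE ?mulr_ge0 ?mxopnorm_ge0 ?l2norm_ge0.
Qed.

Lemma mxopnorm_delta m n i j : mxopnorm (delta_mx i j : 'M[C]_(m, n)) <= 1.
Proof.
apply: mxopnorm_le => // v; rewrite mul1r l2norm_le ?l2norm_ge0// l2norm_sqr.
rewrite (bigD1 i)//= big1 => [|k /negbTE ki].
  rewrite addr0 (_ : (_ *m v) i 0 = v j 0).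
    by rewrite (bigD1 j)//= lerDl sumr_ge0// => k _; exact: sqn_ge0.
  rewrite mxE (bigD1 j)//= mxE !eqxx mul1r big1 ?addr0// => k /negbTE kj.
  by rewrite mxE kj andbF mul0r.
rewrite mxE big1 /sqn ?normc0 ?expr0n// => l _.
by rewrite mxE ki mul0r.
Qed.

Lemma mxopnorm_le_sum m n (a : 'M[C]_(m, n)) :
  mxopnorm a <= \sum_i \sum_j normc (a i j).
Proof.
rewrite {1}[a]matrix_sum_delta.
have sumD (I : finType) (F : I -> 'M[C]_(m, n)) :
    mxopnorm (\sum_i F i) <= \sum_i mxopnorm (F i).
  elim/big_ind2 : _ => [|x1 x2 y1 y2 h1 h2|//].
    by rewrite -(scale0r 0) mxopnormZ normc0 mul0r.
  by rewrite (le_trans (mxopnormD _ _))// lerD.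
apply: le_trans (sumD _ _) _; apply: ler_sum => i _.
apply: le_trans (sumD _ _) _; apply: ler_sum => j _.
by rewrite mxopnormZ ler_piMr ?normc_ge0// mxopnorm_delta.
Qed.

Lemma cvg_sum0 (I : finType) (f : I -> nat -> R) :
  (forall i, f i @ \oo --> 0) -> (fun k => \sum_i f i k) @ \oo --> 0.
Proof.
move=> f0; rewrite (_ : (fun k => _) = \sum_i f i); last first.
  by apply/funext => k; rewrite fct_sumE.
elim/big_ind : _ => [|g h g0 h0|i _]; first exact: cvg_cst.
  by rewrite -[0](addr0 0); exact: cvgD.
exact: f0.
Qed.

Lemma real_complete : complete_for (fun x : R => `|x|).
Proof.
move=> u uC; have : cvg (u @ \oo).
  apply: cauchy_cvg; apply/cauchy_ballP => e e0.
  rewrite near_map2; apply: filterS (uC e e0) => -[k l] /=.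
  by rewrite -ball_normE.
move=> /cvg_ex[x ux]; exists x; apply/norm_cvg0P.
by rewrite -(subrr x); apply: cvgB => //; exact: cvg_cst.
Qed.

Lemma complex_complete : complete_for (@normc R).
Proof.
have ReB (z w : C) : complex.Re (z - w) = complex.Re z - complex.Re w.
  by case: z; case: w.
have ImB (z w : C) : complex.Im (z - w) = complex.Im z - complex.Im w.
  by case: z; case: w.
have Re_le (z : C) : `|complex.Re z| <= normc z.
  case: z => a b /=; rewrite -sqrtr_sqr ler_wsqrtr// lerDl; exact: sqr_ge0.
have Im_le (z : C) : `|complex.Im z| <= normc z.
  case: z => a b /=; rewrite -sqrtr_sqr ler_wsqrtr// lerDr; exact: sqr_ge0.
have norm_le (z : C) : normc z <= `|complex.Re z| + `|complex.Im z|.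
  rewrite -ler_sqr ?nnegrE ?normc_ge0 ?addr_ge0// -/(sqn _) sqnE sqrrD.
  by rewrite !real_normK ?num_real// addrAC lerDl mulrn_wge0 ?mulr_ge0.
move=> u uC.
have [|a ua] := @real_complete (fun k => complex.Re (u k)).
  move=> e /uC; apply: filterS => -[k l] /=; apply: le_lt_trans.
  by rewrite -ReB.
have [|b ub] := @real_complete (fun k => complex.Im (u k)).
  move=> e /uC; apply: filterS => -[k l] /=; apply: le_lt_trans.
  by rewrite -ImB.
exists (a +i* b)%C.
apply: (squeeze_cvgr (f := fun=> 0)
  (h := fun k => `|complex.Re (u k) - a| + `|complex.Im (u k) - b|)).
- apply: nearW => k; rewrite normc_ge0/=; apply: le_trans (norm_le _) _.
  by rewrite ReB ImB.
- exact: cvg_cst.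
- by rewrite -[0](addr0 0); exact: cvgD.
Qed.

Lemma mxopnorm_complete m n : complete_for (@mxopnorm R m n).
Proof.
move=> u uC.
have /choice[a ua] (ij : 'I_m * 'I_n) : exists z : C,
    (fun k => normc (u k ij.1 ij.2 - z)) @ \oo --> 0.
  apply: complex_complete => e /uC; apply: filterS => -[k l] /=.
  apply: le_lt_trans.
  by have := normc_le_mxopnorm (u k - u l) ij.1 ij.2; rewrite !mxE.
exists (\matrix_(i, j) a (i, j)).
apply: (squeeze_cvgr (f := fun=> 0)
  (h := fun k => \sum_i \sum_j normc (u k i j - a (i, j)))).
- apply: nearW => k; rewrite mxopnorm_ge0/=; apply: le_trans (mxopnorm_le_sum _) _.
  by apply: ler_sum => i _; apply: ler_sum => j _; rewrite !mxE.
- exact: cvg_cst.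
- by apply: cvg_sum0 => i; apply: cvg_sum0 => j; exact: (ua (i, j)).
Qed.

End scalar_matrices.

(** * The complex numbers as an operator space *)

(** A copy of [C], so that the module structure over [C] and the matrix norms
are attached to a type of their own. *)
Definition scalars (R : realType) : Type := R[i].

Section scalar_operator_space.
Variable R : realType.

HB.instance Definition _ := GRing.Lmodule.copy (scalars R) (R[i]^o).

Let scnorm n (x : 'M[scalars R]_n) : R := mxopnorm (x : 'M[R[i]]_n).

Let scnormD n (x y : 'M[scalars R]_n) : scnorm (x + y) <= scnorm x + scnorm y.
Proof. exact: mxopnormD. Qed.

Let scnormZ n (c : R[i]) (x : 'M[scalars R]_n) :
  scnorm (map_mx (fun w => c *: w) x) = normc c * scnorm x.
Proof.
rewrite /scnorm -mxopnormZ; congr mxopnorm.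
by apply/matrixP => i j; rewrite !mxE.
Qed.

Let scnorm_eq0 n (x : 'M[scalars R]_n) : scnorm x = 0 -> x = 0.
Proof. exact: mxopnorm_eq0. Qed.

Let scnorm_complete n : complete_for (@scnorm n).
Proof. exact: mxopnorm_complete. Qed.

Let scnorm_dsum m n (x : 'M[scalars R]_m) (y : 'M[scalars R]_n) :
  scnorm (block_mx x 0 0 y) = Num.max (scnorm x) (scnorm y).
Proof. exact: mxopnorm_block_diag. Qed.

Let scnorm_bimod m n (a : 'M[R[i]]_(n, m)) (x : 'M[scalars R]_m)
    (b : 'M[R[i]]_(m, n)) :
  scnorm (bimodmx a x b) <= mxopnorm a * scnorm x * mxopnorm b.
Proof.
rewrite /scnorm (_ : (bimodmx a x b : 'M[R[i]]_n) = a *m x *m b); last first.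
  apply/matrixP => i j; rewrite !mxE exchange_big/=; apply: eq_bigr => l _.
  rewrite !mxE mulr_suml; apply: eq_bigr => k _.
  by rewrite -[LHS]/(a i k * b l j * x k l) mulrAC.
apply: le_trans (mxopnormM _ _) _.
by rewrite ler_wpM2r ?mxopnorm_ge0 ?mxopnormM.
Qed.

HB.instance Definition _ := isOperatorSpace.Build R (scalars R)
  scnormD scnormZ scnorm_eq0 scnorm_complete scnorm_dsum scnorm_bimod.

End scalar_operator_space.

Lemma opnorm_scalars (R : realType) n (x : 'M[scalars R]_n) :
  opnorm x = mxopnorm (x : 'M[R[i]]_n).
Proof. by []. Qed.
(** * Vector functionals of the spatial tensor product *)

Section functionals.
Variable R : realType.
Local Notation C := R[i].

Lemma hnorm_col_sqr (H : hilbertType R) n (xi : 'cV[H]_n) :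
  hnorm_col xi ^+ 2 = \sum_i hnorm (xi i 0) ^+ 2.
Proof. by rewrite sqr_sqrtr// sumr_ge0// => i _; exact: sqr_ge0. Qed.

(** The defining supremum runs over vectors of norm at most one only; this is
its homogeneous form. *)
Lemma embedding_contraction (W : opSpaceType R) (H : hilbertType R)
    (iota : W -> {linear H -> H}) n (x : 'M[W]_n) (xi : 'I_n -> H) :
  complete_embedding iota -> opnorm x <= 1 ->
  \sum_i hnorm (\sum_j iota (x i j) (xi j)) ^+ 2 <= \sum_j hnorm (xi j) ^+ 2.
Proof.
move=> [_ /(_ n x) hx] x1.
have unit (v : 'cV[H]_n) : hnorm_col v <= 1 ->
    hnorm_col (\col_i \sum_j iota (x i j) (v j 0)) <= 1.
  move=> v1; rewrite -lee_fin.
  apply: (@le_trans _ _ (opnorm x)%:E); last by rewrite lee_fin.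
  rewrite -hx; apply: ereal_sup_ubound; exists v => //=.
  congr (hnorm_col _)%:E; apply/matrixP => i j; rewrite !mxE.
  by apply: eq_bigr => k _; rewrite mxE.
pose v : 'cV[H]_n := \col_j xi j.
have vE : \sum_j hnorm (xi j) ^+ 2 = hnorm_col v ^+ 2.
  by rewrite hnorm_col_sqr; apply: eq_bigr => j _; rewrite mxE.
have v0 : 0 <= hnorm_col v by exact: sqrtr_ge0.
rewrite vE; have [v_eq0|vn0] := eqVneq (hnorm_col v) 0.
  have xi0 j : xi j = 0.
    apply: hnorm_eq0; move/eqP: vE; rewrite v_eq0 expr0n/= psumr_eq0.
      by move=> /allP/(_ j (mem_index_enum j)); rewrite sqrf_eq0 => /eqP.
    by move=> ? _; exact: sqr_ge0.
  rewrite big1 ?sqr_ge0// => i _; rewrite big1 ?expr0n//=.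
    by rewrite -(scale0r (0 : H)) hnorm_sqrZ /sqn normc0 expr0n mul0r.
  by move=> j _; rewrite xi0 linear0.
pose c := (hnorm_col v)^-1; have c0 : 0 <= c by rewrite invr_ge0.
have := unit (\col_j (c%:C%C *: xi j)).
have -> : hnorm_col (\col_j (c%:C%C *: xi j)) = 1.
  apply: (pexpIrn (n := 2)) => //; rewrite ?nnegrE ?sqrtr_ge0//.
  rewrite hnorm_col_sqr (eq_bigr (fun j => c ^+ 2 * hnorm (xi j) ^+ 2)).
    by rewrite -mulr_sumr vE -exprMn mulVf// expr1n.
  by move=> j _; rewrite mxE hnorm_sqrZ /sqn normc_realc.
move=> /(_ (lexx _)); set z := hnorm_col _ => z1.
have vp : 0 < hnorm_col v ^+ 2 by rewrite exprn_gt0// lt_neqAle eq_sym vn0.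
rewrite -[leRHS]mulr1 -ler_pdivrMl// -exprVn -/c.
have zE i : \sum_j iota (x i j) ((\col_k (c%:C%C *: xi k)) j 0) =
    c%:C%C *: \sum_j iota (x i j) (xi j).
  by rewrite scaler_sumr; apply: eq_bigr => j _; rewrite mxE linearZ.
have : z ^+ 2 <= 1 by rewrite expr_le1// sqrtr_ge0.
apply: le_trans; rewrite hnorm_col_sqr mulr_sumr; apply: ler_sum => i _.
by rewrite mxE zE hnorm_sqrZ /sqn normc_realc.
Qed.

(** Joint complete contractivity of vector functionals of the spatial tensor
product. The hypothesis on [B] concerns the transposed array, which is how a
contractive matrix over [W] acts when [opposite W] is embedded in [B(K)]; this
is what turns the compression [Y] into a contraction from the indices [(p, b)]
to the indices [(q, d)]. *)
Lemma spatial_form_le (H K L : hilbertType R) (s : {bilinear H -> K -> L})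
    m n (A : 'I_m -> 'I_m -> {linear H -> H}) (B : 'I_n -> 'I_n -> {linear K -> K})
    (T : 'I_m * 'I_n -> 'I_m * 'I_n -> {linear L -> L})
    N (h : 'I_N -> H) (k : 'I_N -> K) N' (h' : 'I_N' -> H) (k' : 'I_N' -> K)
    (v w : 'I_m * 'I_n -> C) :
  (forall h h' k k', hdot (s h k) (s h' k') = hdot h h' * hdot k k') ->
  (forall xi : 'I_m -> H,
     \sum_i hnorm (\sum_j A i j (xi j)) ^+ 2 <= \sum_j hnorm (xi j) ^+ 2) ->
  (forall xi : 'I_n -> K,
     \sum_q hnorm (\sum_p B p q (xi p)) ^+ 2 <= \sum_p hnorm (xi p) ^+ 2) ->
  (forall ip jq x y, T ip jq (s x y) = s (A ip.1 jq.1 x) (B ip.2 jq.2 y)) ->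
  hnorm (\sum_l s (h l) (k l)) <= 1 -> hnorm (\sum_l s (h' l) (k' l)) <= 1 ->
  \sum_ip sqn (v ip) <= 1 -> \sum_jq sqn (w jq) <= 1 ->
  normc (\sum_ip v ip * \sum_jq
    hdot (T ip jq (\sum_l s (h l) (k l))) (\sum_l s (h' l) (k' l)) * w jq) <= 1.
Proof.
move=> hs hA hB hT.
have [sg [e [f [sg0 he hf sgE xiE]]]] := schmidt_decomposition h k hs.
have [ta [e' [f' [ta0 he' hf' taE etaE]]]] := schmidt_decomposition h' k' hs.
move=> xi1 eta1 v1 w1.
have {}sgE : \sum_b sg b ^+ 2 <= 1 by rewrite sgE expr_le1// hnorm_ge0.
have {}taE : \sum_d ta d ^+ 2 <= 1 by rewrite taE expr_le1// hnorm_ge0.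
pose X (id : 'I_m * 'I_N') (jb : 'I_m * 'I_N) :=
  hdot (A id.1 jb.1 (e jb.2)) (e' id.2).
pose Y (qd : 'I_n * 'I_N') (pb : 'I_n * 'I_N) :=
  hdot (B pb.1 qd.1 (f pb.2)) (f' qd.2).
have hX : contractive X by exact: contractive_entries.
have hY : contractive Y.
  exact: (contractive_entries (A := fun q p => B p q)).
have := crossed_product_le hX hY v1 w1 sg0 ta0 sgE taE.
congr (normc _ <= 1).
pose G b d ip jq := X (ip.1, d) (jq.1, b) * Y (jq.2, d) (ip.2, b).
have GE b d : \sum_i \sum_q (\sum_j X (i, d) (j, b) * w (j, q)) *
    (\sum_p Y (q, d) (p, b) * v (i, p)) =
    \sum_ip v ip * \sum_jq G b d ip jq * w jq.
  rewrite sum_pair; apply: eq_bigr => i _.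
  under eq_bigr do rewrite mulr_sumr.
  rewrite exchange_big/=; apply: eq_bigr => p _.
  rewrite sum_pair exchange_big/= mulr_sumr; apply: eq_bigr => q _.
  rewrite mulr_suml mulr_sumr; apply: eq_bigr => j _.
  by rewrite /G/=; ring.
under eq_bigr do under eq_bigr do rewrite GE.
have TE ip jq : hdot (T ip jq (\sum_b (sg b)%:C%C *: s (e b) (f b)))
    (\sum_d (ta d)%:C%C *: s (e' d) (f' d)) =
    \sum_b \sum_d (sg b * ta d)%:C%C * G b d ip jq.
  rewrite [T ip jq _]linear_sum hdot_suml; apply: eq_bigr => b _.
  rewrite hdot_sumr; apply: eq_bigr => d _.
  rewrite [T ip jq _]linearZ hdotZl hdotZr conjc_real hT hs realcM /G /X /Y/=; ring.
rewrite xiE etaE; under [RHS]eq_bigr do under eq_bigr do rewrite TE mulr_suml.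
under [RHS]eq_bigr do rewrite exchange_big mulr_sumr/=.
rewrite [RHS]exchange_big/=; apply: eq_bigr => b _.
under [RHS]eq_bigr do under eq_bigr do rewrite mulr_suml.
under [RHS]eq_bigr do rewrite exchange_big mulr_sumr/=.
rewrite [RHS]exchange_big/=; apply: eq_bigr => d _.
rewrite mulr_sumr; apply: eq_bigr => ip _.
rewrite mulrCA; congr (_ * _); rewrite mulr_sumr; apply: eq_bigr => jq _.
by rewrite mulrA.
Qed.

(** The norm of a matrix is at most one if its bilinear form is bounded by one
on unit vectors: [Z u] is tested against its own normalized conjugate. The
bijection [phi] relabels the indices by pairs. *)
Lemma mxopnorm_le1_form (I : finType) N (phi : 'I_N -> I) (Z : 'M[C]_N)
    (F : I -> I -> C) :
  bijective phi -> (forall r s, Z r s = F (phi r) (phi s)) ->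
  (forall v w : I -> C, \sum_i sqn (v i) <= 1 -> \sum_i sqn (w i) <= 1 ->
     normc (\sum_i v i * \sum_j F i j * w j) <= 1) ->
  mxopnorm Z <= 1.
Proof.
move=> [psi phiK psiK] ZF hF; apply: ge_sup.
  by exists (l2norm (Z *m 0)), 0 => //=; rewrite l2norm0.
move=> _ [u /= u1 <-]; set z := Z *m u.
have [->//|z0] := eqVneq (l2norm z) 0.
have bphi : {on predT, bijective phi} by exact/onW_bij/(Bijective phiK psiK).
pose v i := (z (psi i) 0)^*%C / (l2norm z)%:C%C.
have zp : 0 < l2norm z by rewrite lt_neqAle eq_sym z0 l2norm_ge0.
have sqz i : sqn (v i) = sqn (z (psi i) 0) / l2norm z ^+ 2.
  by rewrite /v sqnM sqnJ {2}/sqn normcV normc_realc ?l2norm_ge0// exprVn.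
have v1 : \sum_i sqn (v i) <= 1.
  rewrite (reindex phi)//=; under eq_bigr do rewrite sqz phiK.
  by rewrite -mulr_suml -l2norm_sqr divff// expf_neq0.
have w1 : \sum_i sqn (u (psi i) 0) <= 1.
  rewrite (reindex phi)//=; under eq_bigr do rewrite phiK.
  by rewrite -l2norm_sqr expr_le1// l2norm_ge0.
have := hF v (fun i => u (psi i) 0) v1 w1.
rewrite (_ : \sum_i _ = (l2norm z)%:C%C).
  by rewrite normc_realc ?l2norm_ge0.
have zn0 : (l2norm z)%:C%C != 0 by apply/eqP => -[] /eqP; rewrite (negbTE z0).
rewrite (reindex phi)//= -[RHS](mulfK zn0) -realcM -expr2 l2norm_sqr sum_sqnE.
rewrite mulr_suml; apply: eq_bigr => r _.
rewrite /v phiK mulrAC; congr (_ / _); rewrite mulrC; congr (_ * _).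
rewrite (reindex phi)//= /z mxE; apply: eq_bigr => t _.
by rewrite phiK ZF.
Qed.

Lemma mxtens_unindex_bij m n : bijective (@mxtens_unindex m n).
Proof.
by exists (@mxtens_index m n); [exact: mxtens_unindexK | exact: mxtens_indexK].
Qed.

(** The index type of the one-by-one matrix norms of bilinear maps is
['I_(1 * m * n)], which is not convertible to ['I_(m * n)]. *)
Lemma mxtens_unindex1_bij m n : bijective (fun r : 'I_(1 * m * n) =>
  ((mxtens_unindex (mxtens_unindex r).1).2, (mxtens_unindex r).2)).
Proof.
exists (fun ip => @mxtens_index (1 * m) n (@mxtens_index 1 m (ord0, ip.1), ip.2)).
  move=> r; rewrite -[in RHS](mxtens_unindexK r).
  rewrite [in RHS](surjective_pairing (mxtens_unindex r)).
  congr (mxtens_index (_, _)).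
  rewrite -[RHS]mxtens_unindexK [in RHS](surjective_pairing (mxtens_unindex _)).
  by rewrite [(mxtens_unindex _).1 in RHS]ord1.
by move=> [i p]; congr (_, _); rewrite mxtens_indexK// mxtens_indexK.
Qed.

End functionals.
(** * Functionals on the projective tensor product *)

Section operator_space_norm.
Variables (R : realType) (W : opSpaceType R).
Implicit Types x y : W.
Local Notation C := R[i].

Lemma vnormD x y : vnorm (x + y) <= vnorm x + vnorm y.
Proof. by rewrite /vnorm raddfD; exact: ler_opnormD. Qed.

Lemma vnormZ (c : C) x : vnorm (c *: x) = normc c * vnorm x.
Proof. by rewrite /vnorm -opnormZ map_const_mx. Qed.

Lemma vnormN x : vnorm (- x) = vnorm x.
Proof. by rewrite -scaleN1r vnormZ normcN normc1 mul1r. Qed.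

Lemma vnormB x y : vnorm (x - y) <= vnorm x + vnorm y.
Proof. by rewrite -(vnormN y) vnormD. Qed.

Lemma vnorm_ge0 x : 0 <= vnorm x.
Proof.
have := vnormB x x; rewrite subrr -(scale0r (0 : W)) vnormZ normc0 mul0r.
by rewrite -mulr2n pmulrn_lge0.
Qed.

Lemma vnorm_eq0 x : vnorm x = 0 -> x = 0.
Proof. by move=> /opnorm_eq0/matrixP/(_ 0 0); rewrite !mxE. Qed.

End operator_space_norm.

Section projective_functional.
Variables (R : realType) (V W : opSpaceType R).
Variables (T : lmodType R[i]) (t : {bilinear V -> W -> T}) (tensT : is_tensor t).
Variables (P : opSpaceType R) (jP : {linear T -> P}).
Hypothesis projP : is_projective_tensor t jP.
Local Notation C := R[i].

(** A functional whose bilinear form is jointly completely contractive lifts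
to a functional on [P] by the universal property with target [C]. The lift is
only known to be completely bounded; that its norm is at most one comes from
the isometry [CB(P, C) = CB_bil(V x W; C)]. *)
Lemma projective_functional_le (lam : {linear T -> scalars R}) :
  (forall m n (x : 'M[V]_m) (y : 'M[W]_n) (v w : 'I_m * 'I_n -> C),
    opnorm x <= 1 -> opnorm y <= 1 ->
    \sum_ip sqn (v ip) <= 1 -> \sum_jq sqn (w jq) <= 1 ->
    normc (\sum_ip v ip * \sum_jq
      (lam (t (x ip.1 jq.1) (y ip.2 jq.2)) : C) * w jq) <= 1) ->
  forall u, normc (lam u : C) <= vnorm (jP u).
Proof.
move=> lam_le.
pose h (x : V) (y : W) : scalars R := lam (t x y).
have hbil : bilinear_for (GRing.Scale.Law.clone _ _ *:%R _)
    (GRing.Scale.Law.clone _ _ *:%R _) h.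
  split=> [y|x] c a b; rewrite /h.
    by rewrite linearPl linearP.
  by rewrite linearPr linearP.
pose hB : {bilinear V -> W -> scalars R} :=
  HB.pack h (bilinear_isBilinear.Build _ _ _ _ _ _ h hbil).
have form_le N m n (phi : 'I_N -> 'I_m * 'I_n) (Z : 'M[scalars R]_N)
    (x : 'M[V]_m) (y : 'M[W]_n) : bijective phi -> opnorm x <= 1 -> opnorm y <= 1 ->
    (forall r s, Z r s = h (x (phi r).1 (phi s).1) (y (phi r).2 (phi s).2)) ->
    opnorm Z <= 1.
  move=> bphi x1 y1 ZE; rewrite opnorm_scalars.
  apply: (mxopnorm_le1_form (F := fun ip jq => h (x ip.1 jq.1) (y ip.2 jq.2)) bphi).
    exact: ZE.
  by move=> v w v1 w1; exact: lam_le.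
have h_le : (cbnorm_bil hB <= 1)%E.
  apply: ge_ereal_sup => _ [m [n [x [y [x1 y1 ->]]]]]; rewrite lee_fin.
  apply: (form_le _ _ _ _ _ _ _ (mxtens_unindex_bij m n) x1 y1) => r s.
  by rewrite mxE.
have [|f f_fin fh] := projective_lift projP (h := hB).
  by apply: le_lt_trans h_le _; rewrite ltry.
have f_lam u : f (jP u) = lam u.
  have [g _ g_uniq] := tensT hB.
  rewrite (g_uniq lam)//.
  exact: (g_uniq (f \o jP)).
(* The complete norm of [f] is that of [h], by the isometry at size one. *)
have f_le p : vnorm p <= 1 -> normc (f p : C) <= 1.
  move=> p1; pose fm : 'M[P -> scalars R]_1 := \matrix_(a, b) (f : P -> scalars R).
  have : (cbnorm_mx fm <= 1)%E.
    rewrite /fm -(projective_isometry projP (f := fun _ _ : 'I_1 => f))//.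
    apply: ge_ereal_sup => _ [m [n [x [y [x1 y1 ->]]]]].
    rewrite lee_fin.
    apply: (form_le _ _ _ _ _ _ _ (mxtens_unindex1_bij m n) x1 y1) => r s.
    by rewrite !mxE fh.
  move=> fm1; rewrite -lee_fin; apply: le_trans fm1.
  pose Z := kronmx (fun g e => g e) fm (const_mx p : 'M[P]_1).
  apply: (@le_trans _ _ (opnorm Z)%:E); last first.
    by apply: ereal_sup_ubound; exists 1%N, (const_mx p).
  rewrite lee_fin opnorm_scalars.
  by have := normc_le_mxopnorm (Z : 'M[C]_(1 * 1)) 0 0; rewrite !mxE.
move=> u; rewrite -f_lam; set p := jP u.
have [p0|pn0] := eqVneq (vnorm p) 0.
  by rewrite (vnorm_eq0 p0) linear0 normc0 vnorm_ge0.
have pp : 0 < vnorm p by rewrite lt_neqAle eq_sym pn0 vnorm_ge0.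
have pV : 0 <= (vnorm p)^-1 by rewrite invr_ge0 ltW.
have := f_le (((vnorm p)^-1)%:C%C *: p).
rewrite vnormZ normc_realc// mulVf// lexx => /(_ isT).
rewrite linearZ -[X in normc X]/(((vnorm p)^-1)%:C%C * (f p : C)) normcM.
by rewrite normc_realc// ler_pdivrMl// mulr1.
Qed.

End projective_functional.
(** * Comparison of the two norms *)

Section embeddings.
Variables (R : realType) (W : opSpaceType R) (H : hilbertType R).
Variables (iota : W -> {linear H -> H}) (emb : complete_embedding iota).
Local Notation C := R[i].

Lemma embedding0 x : iota 0 x = 0.
Proof.
have := emb.1 1 0 0 x; rewrite scaler0 addr0 scale1r => /eqP.
by rewrite -subr_eq0 opprD addNKr oppr_eq0 => /eqP.
Qed.

Lemma embeddingZ c w x : iota (c *: w) x = c *: iota w x.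
Proof. by have := emb.1 c w 0 x; rewrite addr0 embedding0 addr0. Qed.

Lemma embedding_le w x : hnorm (iota w x) <= vnorm w * hnorm x.
Proof.
have unit w' : vnorm w' <= 1 -> hnorm (iota w' x) <= hnorm x.
  move=> w1; have := embedding_contraction (fun=> x) emb w1.
  rewrite !big_ord1 mxE ler_sqr// nnegrE; exact: hnorm_ge0.
have [w0|wn0] := eqVneq (vnorm w) 0.
  rewrite w0 (vnorm_eq0 w0) embedding0 mul0r.
  by rewrite -(scale0r (0 : H)) hnormZ normc0 mul0r.
have wp : 0 < vnorm w by rewrite lt_neqAle eq_sym wn0 vnorm_ge0.
have wV : 0 <= (vnorm w)^-1 by rewrite invr_ge0 ltW.
have := unit (((vnorm w)^-1)%:C%C *: w).
rewrite vnormZ normc_realc// mulVf// lexx embeddingZ hnormZ normc_realc//.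
by move=> /(_ isT); rewrite ler_pdivrMl.
Qed.

Lemma vnorm_embedding_le w (r : R) : 0 <= r ->
  (forall x, hnorm (iota w x) <= r * hnorm x) -> vnorm w <= r.
Proof.
move=> r0 hr; rewrite -lee_fin -emb.2; apply: ge_ereal_sup => _ [xi /= xi1 <-].
rewrite lee_fin; move: xi1; rewrite /hnorm_col !big_ord1 !mxE big_ord1 !mxE.
rewrite !sqrtr_sqr !ger0_norm ?hnorm_ge0// => xi1.
by apply: le_trans (hr _) _; rewrite ler_piMr.
Qed.

End embeddings.

(** For [y] near [z] the value of [<z, y>] is close to [|z|^2]. *)
Lemma hnorm_le_dense (R : realType) (L : hilbertType R) (D : set L) z (r : R) :
  (forall x (e : R), 0 < e -> exists2 y, D y & hnorm (x - y) < e) ->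
  0 <= r -> (forall y, D y -> normc (hdot z y) <= r * hnorm y) -> hnorm z <= r.
Proof.
move=> dD r0 hD; have [->//|z0] := eqVneq (hnorm z) 0.
have zp : 0 < hnorm z by rewrite lt_neqAle eq_sym z0 hnorm_ge0.
apply/ler_addgt0Pr => e e0.
(* This choice gives [(hnorm z + r) * d <= e * hnorm z]. *)
pose d := e * hnorm z / (hnorm z + r + 1).
have sp : 0 < hnorm z + r + 1 by rewrite ltr_wpDl// addr_ge0// ltW.
have dp : 0 < d by rewrite divr_gt0 ?mulr_gt0.
have [y Dy zy] := dD z d dp.
have yz : hnorm y <= hnorm z + d.
  have {1}-> : y = z - (z - y) by rewrite subKr.
  apply: le_trans (hnorm_triangle _ _) _.
  by rewrite lerD2l -scaleN1r hnormZ normcN normc1 mul1r ltW.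
rewrite -(ler_pM2r zp).
have -> : hnorm z * hnorm z = normc (hdot z (z - y) + hdot z y).
  by rewrite -hdotDr subrK hdot_sqr normc_realc ?sqr_ge0.
apply: le_trans (le_normcD _ _) _.
apply: (@le_trans _ _ (hnorm z * d + r * (hnorm z + d))).
  apply: lerD; last by apply: le_trans (hD _ Dy) _; rewrite ler_wpM2l.
  by apply: le_trans (hdot_le _ _) _; rewrite ler_wpM2l ?hnorm_ge0// ltW.
rewrite mulrDr addrCA mulrDl lerD2l -mulrDl.
have -> : e * hnorm z = (hnorm z + r + 1) * d.
  by rewrite /d mulrCA divff ?mulr1// gt_eqF.
by apply: ler_wpM2r; [exact: ltW | rewrite lerDl].
Qed.

Section comparison.
Variables (R : realType) (V W : opSpaceType R).
Variables (T : lmodType R[i]) (t : {bilinear V -> W -> T}) (tensT : is_tensor t).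
Variables (P : opSpaceType R) (jP : {linear T -> P}).
Hypothesis projP : is_projective_tensor t jP.
Variables (M : opSpaceType R) (jM : {linear T -> M}).
Hypothesis minM :
  is_minimal_tensor (t : {bilinear V -> opposite W -> T}) jM.

(** The vector functionals given by unit finite tensors [xi] and [eta] are
covered by [spatial_form_le] and [projective_functional_le]. Density of the
finite tensors extends the estimate to all [eta], which bounds
[Theta (jM u) xi], and then to all [xi], because [Theta (jM u)] is bounded. *)
Lemma minimal_le_projective u : vnorm (jM u) <= vnorm (jP u).
Proof.
have [_ _ [H [K [L [s [iV [iW [Th [[hs dense] eV eW eM ThE]]]]]]]]] := minM.
pose D : set L := [set x | exists n (h : 'I_n -> H) (k : 'I_n -> K),
  x = \sum_(l < n) s (h l) (k l)].
have DZ c x : D x -> D (c *: x).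
  move=> [n [h [k ->]]]; exists n, (fun l => c *: h l), k.
  by rewrite scaler_sumr; apply: eq_bigr => l _; rewrite linearZl_LR.
have dD x (e : R) : 0 < e -> exists2 y, D y & hnorm (x - y) < e.
  move=> /(dense x)[n [h [k hk]]]; exists (\sum_(l < n) s (h l) (k l)) => //.
  by exists n, h, k.
have unit xi eta : D xi -> D eta -> hnorm xi <= 1 -> hnorm eta <= 1 ->
    normc (hdot (Th (jM u) xi) eta) <= vnorm (jP u).
  move=> [N [h [k ->]]] [N' [h' [k' ->]]] xi1 eta1.
  set xi0 := \sum_l _ in xi1 *; set eta0 := \sum_l _ in eta1 *.
  pose lam v : scalars R := hdot (Th (jM v) xi0) eta0.
  have lamL : linear lam.
    by move=> c a b; rewrite /lam linearP eM.1 hdotDl hdotZl.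
  pose lamB : {linear T -> scalars R} :=
    HB.pack lam (GRing.isLinear.Build _ _ _ _ lam lamL).
  apply: (projective_functional_le tensT projP (lam := lamB)).
  move=> m n x y v w x1 y1 v1 w1.
  apply: (spatial_form_le (A := fun i j => iV (x i j)) (B := fun p q => iW (y p q))
    (T := fun ip jq => Th (jM (t (x ip.1 jq.1) (y ip.2 jq.2))))) => //.
  - by move=> z; exact: embedding_contraction.
  (* The norm of [y^T] over [opposite W] is that of [y] over [W]. *)
  - move=> z; have yT : opnorm (y^T : 'M[opposite W]_n) <= 1.
      by rewrite -[y]trmxK in y1.
    have := embedding_contraction z eW yT.
    by under eq_bigr do under eq_bigr do rewrite mxE.
have form_le xi eta : D xi -> D eta ->
    normc (hdot (Th (jM u) xi) eta) <= vnorm (jP u) * hnorm xi * hnorm eta.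
  move=> Dxi Deta.
  have [/hnorm_eq0->|xn0] := eqVneq (hnorm xi) 0.
    by rewrite linear0 hdot0l normc0 !mulr_ge0 ?vnorm_ge0 ?hnorm_ge0.
  have [/hnorm_eq0->|en0] := eqVneq (hnorm eta) 0.
    by rewrite hdot0r normc0 !mulr_ge0 ?vnorm_ge0 ?hnorm_ge0.
  have xp : 0 < hnorm xi by rewrite lt_neqAle eq_sym xn0 hnorm_ge0.
  have ep : 0 < hnorm eta by rewrite lt_neqAle eq_sym en0 hnorm_ge0.
  have xV : 0 <= (hnorm xi)^-1 by rewrite invr_ge0 ltW.
  have eV' : 0 <= (hnorm eta)^-1 by rewrite invr_ge0 ltW.
  have := unit _ _ (DZ ((hnorm xi)^-1)%:C%C _ Dxi) (DZ ((hnorm eta)^-1)%:C%C _ Deta).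
  rewrite !hnormZ !normc_realc// !mulVf// lexx => /(_ isT isT).
  rewrite [Th _ _]linearZ hdotZl hdotZr conjc_real !normcM !normc_realc//.
  rewrite ler_pdivrMl// ler_pdivrMl//.
  by congr (_ <= _); ring.
have D_le xi : D xi -> hnorm (Th (jM u) xi) <= vnorm (jP u) * hnorm xi.
  move=> Dxi; apply: (hnorm_le_dense dD) => [|eta Deta]; last exact: form_le.
  by rewrite mulr_ge0 ?vnorm_ge0 ?hnorm_ge0.
apply: (vnorm_embedding_le eM) => [|x]; first exact: vnorm_ge0.
apply/ler_addgt0Pr => e e0; set c := vnorm (jP u); set b := vnorm (jM u).
have sp : 0 < c + b + 1 by rewrite ltr_wpDl// addr_ge0 ?vnorm_ge0.
have [y Dy xy] := dD x (e / (c + b + 1)) (divr_gt0 e0 sp).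
have yx : hnorm y <= hnorm x + e / (c + b + 1).
  have {1}-> : y = x - (x - y) by rewrite subKr.
  apply: le_trans (hnorm_triangle _ _) _.
  by rewrite lerD2l -scaleN1r hnormZ normcN normc1 mul1r ltW.
rewrite -[x in leLHS](subrK y) linearD; apply: le_trans (hnorm_triangle _ _) _.
apply: (@le_trans _ _ (b * (e / (c + b + 1)) + c * (hnorm x + e / (c + b + 1)))).
  apply: lerD.
    by apply: le_trans (embedding_le eM _ _) _; rewrite ler_wpM2l ?vnorm_ge0// ltW.
  by apply: le_trans (D_le _ Dy) _; rewrite ler_wpM2l ?vnorm_ge0.
rewrite mulrDr addrCA lerD2l -mulrDl mulrCA; apply: ler_piMr; first exact: ltW.
by rewrite ler_pdivrMr// mul1r addrC lerDl.
Qed.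

End comparison.

(** * Extension to the completion *)

(** Extension by continuity: the value at [p] is the limit of [jM (u k)] for
any [u k] with [jP (u k)] converging to [p]. *)
Lemma contraction_extension (R : realType) (T : lmodType R[i])
    (P M : opSpaceType R) (jP : {linear T -> P}) (jM : {linear T -> M}) :
  dense_range jP -> (forall u, vnorm (jM u) <= vnorm (jP u)) ->
  exists Psi : {linear P -> M},
    (forall u, Psi (jP u) = jM u) /\ (forall p, vnorm (Psi p) <= vnorm p).
Proof.
move=> dP jMP.
(* The graph of the extension, as the closure of the pairs [(jP u, jM u)]. *)
pose graph p m := forall e : R, 0 < e ->
  exists2 u, vnorm (p - jP u) < e & vnorm (m - jM u) < e.
have graph_lin c p q m n : graph p m -> graph q n -> graph (c *: p + q) (c *: m + n).
  move=> pm qn e e0; pose d := e / (normc c + 1).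
  have cp : 0 < normc c + 1 by rewrite ltr_wpDl// normc_ge0.
  have d0 : 0 < d by rewrite divr_gt0.
  have [u pu mu] := pm d d0; have [v qv nv] := qn d d0.
  have dE : e = normc c * d + d by rewrite /d; field; rewrite gt_eqF.
  have split_le (X : opSpaceType R) (x y x' y' : X) : vnorm (x - x') < d ->
      vnorm (y - y') < d -> vnorm (c *: x + y - (c *: x' + y')) < e.
    move=> hx hy; rewrite opprD addrACA -scalerBr dE.
    apply: le_lt_trans (vnormD _ _) _; rewrite vnormZ ler_ltD//.
    by rewrite ler_wpM2l ?normc_ge0// ltW.
  by exists (c *: u + v); rewrite linearP; exact: split_le.
have graph_le p m : graph p m -> vnorm m <= vnorm p.
  move=> pm; apply/ler_addgt0Pr => e e0.
  have e20 : 0 < e / 2 by rewrite divr_gt0.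
  have [u pu mu] := pm _ e20.
  have h1 : vnorm m <= vnorm (m - jM u) + vnorm (jM u).
    by rewrite -{1}[m](subrK (jM u)) vnormD.
  have h2 : vnorm (jP u) <= vnorm (p - jP u) + vnorm p.
    have {1}-> : jP u = p - (p - jP u) by rewrite subKr.
    by rewrite [leRHS]addrC vnormB.
  have := jMP u; lra.
have graph_ex p : exists m, graph p m.
  have /choice[u hu] (k : nat) : exists u, vnorm (p - jP u) < k.+1%:R^-1.
    by apply: dP; rewrite invr_gt0.
  have uC (e : R) : 0 < e -> \forall k & l \near \oo,
      opnorm (const_mx (jM (u k)) - const_mx (jM (u l)) : 'M[M]_1) < e.
    move=> e0; have e20 : 0 < e / 2 by rewrite divr_gt0.
    have small : \forall k \near \oo, vnorm (p - jP (u k)) < e / 2.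
      have := near_infty_natSinv_lt (PosNum e20); apply: filterS => k.
      exact/lt_trans.
    exists ([set k | vnorm (p - jP (u k)) < e / 2],
            [set k | vnorm (p - jP (u k)) < e / 2]) => // -[k l] /= [hk hl].
    rewrite -raddfB -[X in X < _]/(vnorm _) -linearB.
    apply: le_lt_trans (jMP _) _.
    have -> : jP (u k - u l) = (p - jP (u l)) - (p - jP (u k)).
      by rewrite linearB opprB [RHS]addrC addrA subrK.
    apply: le_lt_trans (vnormB _ _) _.
    by rewrite [e]splitr ltrD.
  have [X /cvgr0Pnorm_lt uX] :=
    @opnorm_complete R M 1 (fun k => const_mx (jM (u k))) uC.
  exists (X 0 0) => e e0.
  have := near_infty_natSinv_lt (PosNum e0); have := uX e e0.
  move=> /filterI/[apply]/filter_ex[k [/= hX hk]].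
  exists (u k); first exact: lt_trans (hu k) hk.
  rewrite -vnormN opprB; apply: le_lt_trans hX.
  apply: le_trans (ler_norm _); rewrite le_eqVlt; apply/orP; left; apply/eqP.
  congr opnorm; apply/matrixP => a b.
  by rewrite !mxE !ord1.
have graph_uniq p m n : graph p m -> graph p n -> m = n.
  move=> pm pn; apply/eqP; rewrite -subr_eq0; apply/eqP/vnorm_eq0.
  have := graph_le _ _ (graph_lin (-1) _ _ _ _ pn pm).
  rewrite !scaleN1r addNr addrC => h; apply/eqP; rewrite eq_le vnorm_ge0 andbT.
  by apply: le_trans h _; rewrite -(scale0r (0 : P)) vnormZ normc0 mul0r.
have graph_jP u : graph (jP u) (jM u).
  move=> e e0; exists u;
    by rewrite subrr -[X in vnorm X](scale0r 0) vnormZ normc0 mul0r.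
have /choice[Psi PsiP] := graph_ex.
have PsiL : linear Psi.
  by move=> c p q; apply: graph_uniq (PsiP _) _; exact: graph_lin.
pose PsiB : {linear P -> M} :=
  HB.pack Psi (GRing.isLinear.Build _ _ _ _ Psi PsiL).
exists PsiB; split=> /= [u|p].
  exact: graph_uniq (PsiP _) (graph_jP u).
exact: graph_le.
Qed.

Theorem theorem1p1 (R : realType) (V W : opSpaceType R)
    (T : lmodType R[i]) (t : {bilinear V -> W -> T}) (tensT : is_tensor t)
    (P : opSpaceType R) (jP : {linear T -> P})
    (projP : is_projective_tensor t jP)
    (M : opSpaceType R) (jM : {linear T -> M})
    (minM : is_minimal_tensor (t : {bilinear V -> opposite W -> T}) jM) :
  exists Psi : {linear P -> M},
    (forall u : T, Psi (jP u) = jM u) /\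
    (forall p : P, vnorm (Psi p) <= vnorm p).
Proof.
apply: contraction_extension (projective_dense projP) _.
exact: (minimal_le_projective tensT projP minM).
Qed.
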